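(* Let $Q$ be a quiver and let $(\mathcal V,\mathcal F)$ and $(\mathcal W,\mathcal G)$ be filtered dimension vectors, such that for each $x\in Q_0$ the filtrations $F_x$ and $G_x$ have the same length. Then $$\mathrm{ext}_{Q,\mathcal F,\mathcal G}(\mathcal V,\mathcal W)=-\min_{\mathcal S\subseteq_Q\mathcal V}\mathrm{eul}_{Q,\mathcal F_{\mathcal S},\mathcal G}(\mathcal S,\mathcal W),$$ where the minimum is over all $\mathcal S\subseteq_Q\mathcal V$, including $\mathcal S=(\{0\})$ and $\mathcal S=\mathcal V$.
   Context: All vector spaces are finite-dimensional over $\mathbb C$. A quiver $Q=(Q_0,Q_1)$ has a finite vertex set $Q_0$ and a finite arrow set $Q_1$ (cycles and multiple arrows allowed). For families of vector spaces $\mathcal V=(V_x)_{x\in Q_0}$, $\mathcal W=(W_x)_{x\in Q_0}$ put $\mathcal H_Q(\mathcal V,\mathcal W)=\bigoplus_{a\colon x\to y\in Q_1}\mathrm{Hom}(V_x,W_y)$ and $\mathcal H_Q(\mathcal V)=\mathcal H_Q(\mathcal V,\mathcal V)$. $\mathcal S\subseteq\mathcal V$ means $\mathcal S=(S_x)$ with each $S_x$ a subspace of $V_x$; for $v\in\mathcal H_Q(\mathcal V)$, $v\mathcal S\subseteq\mathcal S$ means $v_aS_x\subseteq S_y$ for every arrow $a\colon x\to y$. A (complete) filtration $F$ on a vector space $V$ is a chain $\{0\}=F(0)\subseteq\dots\subseteq F(\ell)=V$ with $\dim F(i+1)\le\dim F(i)+1$ for all $i$ (the subspaces need not be strictly increasing;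 $\ell$ is the length). A filtered dimension vector $(\mathcal V,\mathcal F)$ is a family $\mathcal V$ with a family $\mathcal F=(F_x)$ of filtrations $F_x$ on $V_x$. For $\mathcal S\subseteq\mathcal V$, the induced filtrations $\mathcal F_{\mathcal S}$ on $\mathcal S$ are given by $F_x(i)\cap S_x$. $\mathcal S\subseteq_Q\mathcal V$ ($\mathcal S$ is $Q$-intersecting in $\mathcal V$) means: for every $v\in\mathcal H_Q(\mathcal V)$ there is $\mathcal T$ with $v\mathcal T\subseteq\mathcal T$ in the closure, in $\prod_x\mathrm{Gr}(\dim S_x,V_x)$, of the orbit of $\mathcal S$ under $B_Q(\mathcal V,\mathcal F)=\prod_xB_x$, where $B_x\subseteq\mathrm{GL}(V_x)$ is the Borel subgroup preserving $F_x$. $\mathfrak g_{Q,\mathcal F,\mathcal G}(\mathcal V,\mathcal W)$ is the space of families $\Phi=(\Phi_x)_{x\in Q_0}$ of linear maps $\Phi_x\colon V_x\to W_x$ with $\Phi_x(F_x(i))\subseteq G_x(i)$ for all $i$. The filtered Euler number is $\mathrm{eul}_{Q,\mathcal F,\mathcal G}(\mathcal V,\mathcal W)=\dim\mathfrak g_{Q,\mathcal F,\mathcal G}(\mathcal V,\mathcal W)-\dim\mathcal H_Q(\mathcal V,\mathcal W)$. For $v\in\mathcal H_Q(\mathcal V)$, $w\in\mathcal H_Q(\mathcal W)$ let $\delta_{v,w}\colon\mathfrak g_{Q,\mathcal F,\mathcal G}(\mathcal V,\mathcal W)\to\mathcal H_Q(\mathcal V,\mathcal W)$, $\Phi\mapsto(\Phi_yv_a-w_a\Phi_x)_{a\colon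 x\to y}$. Set $\mathrm{Ext}_{Q,\mathcal F,\mathcal G}(v,w)=\mathrm{coker}(\delta_{v,w})$ and $\mathrm{ext}_{Q,\mathcal F,\mathcal G}(\mathcal V,\mathcal W)=\min_{v\in\mathcal H_Q(\mathcal V),\,w\in\mathcal H_Q(\mathcal W)}\dim\mathrm{Ext}_{Q,\mathcal F,\mathcal G}(v,w)$. *)

(* Defs.v *)
From HB Require Import structures.
From mathcomp Require Import all_boot all_order all_algebra.
From mathcomp Require Import complex.
From mathcomp Require Import all_classical all_reals all_analysis.
Import GRing.Theory Num.Theory.
Import numFieldNormedType.Exports.

Set Implicit Arguments.
Unset Strict Implicit.
Unset Printing Implicit Defensive.

Local Open Scope classical_set_scope.
Local Open Scope ring_scope.

(* MathComp makes {ffun I -> V} a vector space only for a constant family V;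
   this is the same construction for a family of spaces indexed by I. *)
Definition dirsum (K : fieldType) (I : finType) (E : I -> vectType K) :=
  {dffun forall i, E i}.

Section DirectSum.
Variables (K : fieldType) (I : finType) (E : I -> vectType K).
Local Notation D := (dirsum E).
Implicit Types f g : D.

HB.instance Definition _ := Choice.copy D {dffun forall i, E i}.

Definition dirsum_zero : D := [ffun i => 0 : E i].
Definition dirsum_opp f : D := [ffun i => - f i : E i].
Definition dirsum_add f g : D := [ffun i => f i + g i : E i].
Definition dirsum_scale (k : K) f : D := [ffun i => k *: f i : E i].

Fact dirsum_addA : associative dirsum_add.
Proof. by move=> f g h; apply/ffunP=> i; rewrite !ffunE addrA. Qed.
Fact dirsum_addC : commutative dirsum_add.
Proof. by move=> f g; apply/ffunP=> i; rewrite !ffunE addrC. Qed.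
Fact dirsum_add0 : left_id dirsum_zero dirsum_add.
Proof. by move=> f; apply/ffunP=> i; rewrite !ffunE add0r. Qed.
Fact dirsum_addN : left_inverse dirsum_zero dirsum_opp dirsum_add.
Proof. by move=> f; apply/ffunP=> i; rewrite !ffunE addNr. Qed.

HB.instance Definition _ := GRing.isZmodule.Build D
  dirsum_addA dirsum_addC dirsum_add0 dirsum_addN.

Lemma dirsumDE f g i : (f + g) i = f i + g i. Proof. exact: ffunE. Qed.

Fact dirsum_scaleA a b f :
  dirsum_scale a (dirsum_scale b f) = dirsum_scale (a * b) f.
Proof. by apply/ffunP=> i; rewrite !ffunE scalerA. Qed.
Fact dirsum_scale1 : left_id 1 dirsum_scale.
Proof. by move=> f; apply/ffunP=> i; rewrite !ffunE scale1r. Qed.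
Fact dirsum_scaleDr : right_distributive dirsum_scale +%R.
Proof.
by move=> a f g; apply/ffunP=> i; rewrite [LHS]ffunE !dirsumDE !ffunE scalerDr.
Qed.
Fact dirsum_scaleDl f : {morph dirsum_scale^~ f : a b / a + b}.
Proof.
by move=> a b; apply/ffunP=> i; rewrite [LHS]ffunE dirsumDE !ffunE scalerDl.
Qed.

HB.instance Definition _ := GRing.Zmodule_isLmodule.Build K D
  dirsum_scaleA dirsum_scale1 dirsum_scaleDr dirsum_scaleDl.

Lemma dirsumZE (a : K) f i : (a *: f) i = a *: f i. Proof. exact: ffunE. Qed.

Import VectorInternalTheory.

Local Notation coord_index := {i : I & 'I_(dim (E i))}.

Fact dirsum_vect_iso : Vector.axiom #|{: coord_index}| D.
Proof.
pose to (f : D) : 'rV[K]_#|{: coord_index}| :=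
  \row_j v2r (f (tag (enum_val j))) 0 (tagged (enum_val j)).
pose from (r : 'rV[K]_#|{: coord_index}|) : D :=
  [ffun i => r2v (\row_k r 0 (enum_rank (Tagged _ k : coord_index))) : E i].
exists to => [a f g|].
  by apply/rowP=> j; rewrite !mxE dirsumDE dirsumZE linearP !mxE.
exists from => [f|r].
  apply/ffunP=> i; rewrite ffunE; apply: (canLR v2rK).
  by apply/rowP=> k; rewrite !mxE enum_rankK.
apply/rowP=> j; rewrite !mxE ffunE r2vK mxE; congr (r 0 _).
by rewrite -[RHS]enum_valK; congr enum_rank; case: (enum_val j).
Qed.

HB.instance Definition _ := Lmodule_hasFinDim.Build K D dirsum_vect_iso.

End DirectSum.

Record quiver := Quiver {
  vertex : finType;
  arrow : finType;
  src : arrow -> vertex;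
  tgt : arrow -> vertex }.
Arguments src {q}.
Arguments tgt {q}.

Section QuiverReps.
Variables (K : fieldType) (Q : quiver).
Implicit Types V W : vertex Q -> vectType K.

Definition hom_sum V W := dirsum (fun x => 'Hom(V x, W x)).
HB.instance Definition _ V W := Vector.on (hom_sum V W).

Definition rep_sum V W := dirsum (fun a : arrow Q => 'Hom(V (src a), W (tgt a))).
HB.instance Definition _ V W := Vector.on (rep_sum V W).

Definition subfamily V := forall x, {vspace V x}.

Definition subrep V (v : rep_sum V V) (S : subfamily V) : Prop :=
  forall a, (v a @: S (src a) <= S (tgt a))%VS.

Definition subfamily_space V (S : subfamily V) : vertex Q -> vectType K :=
  fun x => subvs_of (S x).

Definition subspace_chain V (l : vertex Q -> nat) :=
  forall x, 'I_(l x).+1 -> {vspace V x}.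

Definition complete_filtration (E : vectType K) (l : nat)
    (F : 'I_l.+1 -> {vspace E}) : Prop :=
  [/\ F ord0 = 0%VS, F ord_max = fullv &
      forall i j : 'I_l.+1, j = i.+1 :> nat ->
        (F i <= F j)%VS /\ (\dim (F j) <= (\dim (F i)).+1)%N].

Definition induced_chain V l (F : subspace_chain V l) (S : subfamily V) :
    subspace_chain (subfamily_space S) l :=
  fun x i => (linfun (vsval : subvs_of (S x) -> V x) @^-1: F x i)%VS.

Lemma mem_induced_chain V l (F : subspace_chain V l) (S : subfamily V) x i
    (u : subvs_of (S x)) :
  (u \in induced_chain F S i) = (vsval u \in (F x i :&: S x)%VS).
Proof. by rewrite -memv_preim lfunE memv_cap subvsP andbT. Qed.

Lemma induced_chainE V l (F : subspace_chain V l) (S : subfamily V) x i :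
  (linfun (vsval : subvs_of (S x) -> V x) @: induced_chain F S i)%VS
  = (F x i :&: S x)%VS.
Proof.
apply/vspaceP => u; apply/memv_imgP/idP => [[w wI ->]|uFS].
  by rewrite lfunE -mem_induced_chain.
have uS : u \in S x by move: uFS; rewrite memv_cap => /andP[].
exists (vsproj (S x) u); last by rewrite lfunE /= vsprojK.
by rewrite mem_induced_chain vsprojK.
Qed.

Section FilteredHom.
Variables (V W : vertex Q -> vectType K) (l : vertex Q -> nat).
Variables (F : subspace_chain V l) (G : subspace_chain W l).

Definition eval_hom (x : vertex Q) (u : V x) (Phi : hom_sum V W) : W x :=
  Phi x u.

Fact eval_hom_linear x (u : V x) : linear (eval_hom u).
Proof.
by move=> a f g; rewrite /eval_hom dirsumDE dirsumZE add_lfunE scale_lfunE.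
Qed.
HB.instance Definition _ x (u : V x) :=
  GRing.isLinear.Build K (hom_sum V W) (W x) _ (eval_hom u)
    (eval_hom_linear u).

(* The condition Phi_x(F_x(i)) <= G_x(i) is tested on a basis of F_x(i) so
   that it is a finite intersection of subspaces; see filtered_homP. *)
Definition filtered_hom : {vspace hom_sum V W} :=
  (\bigcap_(x : vertex Q) \bigcap_(i < (l x).+1)
     \bigcap_(u <- vbasis (F i)) (linfun (eval_hom u) @^-1: G i))%VS.

Lemma filtered_homP (Phi : hom_sum V W) :
  Phi \in filtered_hom <-> forall x i, (Phi x @: F (x:=x) i <= G i)%VS.
Proof.
have mem_bigcap (J : Type) (r : seq J) (U : J -> {vspace hom_sum V W}) :
    (Phi \in (\bigcap_(j <- r) U j)%VS) = all (fun j => Phi \in U j) r.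
  by elim: r => [|j r IHr]; rewrite ?big_nil ?memvf// big_cons memv_cap IHr.
have bigcapP (J : finType) (U : J -> {vspace hom_sum V W}) :
    reflect (forall j, Phi \in U j) (Phi \in (\bigcap_j U j)%VS).
  rewrite mem_bigcap; apply: (iffP allP) => [PU j|PU j _]; last exact: PU.
  by apply: PU; rewrite mem_index_enum.
have inner x (i : 'I_(l x).+1) :
    (Phi \in (\bigcap_(u <- vbasis (F i)) (linfun (eval_hom u) @^-1: G i))%VS)
    = (Phi x @: F i <= G i)%VS.
  rewrite mem_bigcap -[X in (_ @: X)%VS](span_basis (vbasisP (F i))) limg_span.
  rewrite (sameP span_subvP allP) all_map; apply: eq_all => u /=.
  by rewrite -memv_preim lfunE.
split=> [/bigcapP Phi_in x i|Phi_in].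
  by have /bigcapP/(_ i) := Phi_in x; rewrite inner.
by apply/bigcapP => x; apply/bigcapP => i; rewrite inner.
Qed.

Definition eul : int := (\dim filtered_hom)%:Z - (\dim {:rep_sum V W})%:Z.

Definition delta_fun (v : rep_sum V V) (w : rep_sum W W) (Phi : hom_sum V W) :
    rep_sum V W :=
  [ffun a => ((Phi (tgt a) \o v a)%VF - (w a \o Phi (src a))%VF)
             : 'Hom(V (src a), W (tgt a))].

Fact delta_fun_linear v w : linear (delta_fun v w).
Proof.
move=> k f g; apply/ffunP => a; apply/lfunP => u.
rewrite !(ffunE, dirsumDE, dirsumZE) !(add_lfunE, opp_lfunE, scale_lfunE).
rewrite !comp_lfunE !(add_lfunE, scale_lfunE) linearP.
by rewrite scalerDr opprD scalerN addrACA.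
Qed.
HB.instance Definition _ v w :=
  GRing.isLinear.Build K (hom_sum V W) (rep_sum V W) _ (delta_fun v w)
    (delta_fun_linear v w).

Definition delta v w : 'Hom(hom_sum V W, rep_sum V W) := linfun (delta_fun v w).

(* MathComp has no quotient vector spaces: the cokernel of the restriction of
   delta to filtered_hom is represented by a complement of its image. *)
Definition Ext v w : {vspace rep_sum V W} := ((delta v w @: filtered_hom)^C)%VS.

Definition ext_values : set nat :=
  [set n | exists (v : rep_sum V V) (w : rep_sum W W), n = \dim (Ext v w)].

Fact ext_values_ex : exists n, `[< ext_values n >].
Proof. by exists (\dim (Ext 0 0)); apply/asboolP; exists 0, 0. Qed.

Definition ext : nat := ex_minn ext_values_ex.

End FilteredHom.

Definition borel (E : vectType K) (l : nat) (F : 'I_l.+1 -> {vspace E})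
    (b : 'End(E)) : Prop :=
  lker b = 0%VS /\ forall i, (b @: F i)%VS = F i.

End QuiverReps.

Definition grass (K : fieldType) (r : nat) (E : vectType K) :=
  {U : {vspace E} | \dim U == r}.
HB.instance Definition _ K r E := Choice.on (@grass K r E).

Section GrassmannTopology.
Variables (C : numFieldType) (r : nat) (E : vectType C).

Definition frame_span (M : 'M[C]_(r, \dim {:E})) : {vspace E} :=
  <<[seq passmx.vecof (vbasis fullv) (row i M) | i : 'I_r]>>%VS.

Definition is_frame (U : grass r E) (M : 'M[C]_(r, \dim {:E})) : Prop :=
  frame_span M = val U.

(* Quotient topology for the surjection frame_span from the space of
   linearly independent r-frames, which has the subspace topology of
   'M[C]_(r, \dim {:E}), onto the Grassmannian. *)
Definition grass_open (O : set (grass r E)) : Prop :=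
  exists2 A : set 'M[C]_(r, \dim {:E}), open A &
    forall U M, is_frame U M -> (A M <-> O U).

Fact grass_openT : grass_open setT.
Proof. by exists setT => //; exact: openT. Qed.

Fact grass_openI : setI_closed grass_open.
Proof.
move=> O1 O2 [A1 oA1 A1P] [A2 oA2 A2P]; exists (A1 `&` A2); first exact: openI.
move=> U M UM; split=> -[].
  by move=> /(A1P _ _ UM) ? /(A2P _ _ UM) ?.
by move=> /(A1P _ _ UM) ? /(A2P _ _ UM) ?.
Qed.

Fact grass_open_bigU (J : Type) (O : J -> set (grass r E)) :
  (forall j, grass_open (O j)) -> grass_open (\bigcup_j O j).
Proof.
move=> oO; have /choice[A AP] j : exists A : set 'M[C]_(r, \dim {:E}),
    open A /\ forall U M, is_frame U M -> (A M <-> O j U).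
  by have [A ? ?] := oO j; exists A.
exists (\bigcup_j A j); first by apply: bigcup_open => j _; case: (AP j).
move=> U M UM; split=> -[j _ Hj]; exists j => //.
  exact/((AP j).2 U M UM).
exact/((AP j).2 U M UM).
Qed.

HB.instance Definition _ := isOpenTopological.Build (grass r E)
  grass_openT grass_openI grass_open_bigU.

End GrassmannTopology.

Section Intersecting.
Variables (C : numFieldType) (Q : quiver) (V : vertex Q -> vectType C).
Variables (l : vertex Q -> nat) (F : subspace_chain V l).

Definition grass_prod (S : subfamily V) :=
  prod_topology (fun x => grass (\dim (S x)) (V x)).

Definition borel_orbit (S : subfamily V) : set (grass_prod S) :=
  [set T | exists2 b : hom_sum V V, forall x, borel (@F x) (b x) &
             forall x, val (T x) = (b x @: S x)%VS].

Definition Qintersecting (S : subfamily V) : Prop :=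
  forall v : rep_sum V V, exists2 T : grass_prod S,
    closure (@borel_orbit S) T & subrep v (fun x => val (T x)).

End Intersecting.

Definition is_minimum (A : set int) (m : int) : Prop := A m /\ lbound A m.

(* Main.v *)
(* Lower bound: let [S] be Q-intersecting. Every [v] stabilises some [T] in the
   closure of the Borel orbit of [S]. Restriction maps [Ext(v, w)] onto
   [Ext(v|T, w)], whose dimension is at least [- eul(T, W)]. Intersections with
   the steps of [F] can only grow in the closure, so the jumps of [T] come no
   later than those of [S], and [eul(T, W) <= eul(S, W)].

   Upper bound: among the pairs [(v, w)] with minimal [Ext] and the [Phi] in the
   kernel of [delta v w], choose one of maximal ranks, with kernel [K] and image
   [I]. Any first-order change of [(v, w)] is matched by a polynomial
   deformation of [Phi], whose tangent must map [K] into [I] because ranks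
   cannot increase. Hence [Ext(v, w)] has the dimension of [Ext(K, W/I)],
   computed where [Hom(K, W/I)] vanishes, so [ext(V, W) <= ext(K, W)]; if
   [Phi = 0] this reads [ext(V, W) = - eul(V, W)]. The kernel varies
   algebraically with [v], so a generic [v] has a subrepresentation isometric to
   [K], and induction on [dim V] ends with a generic subrepresentation [D] such
   that [ext(V, W) <= - eul(D, W)]. Limits of subrepresentations along lines
   through the generic locus show that [D] is realised by some Q-intersecting
   [S]. *)
Require Import Defs.
From mathcomp Require Import zify.
From HB Require Import structures.
From mathcomp Require Import all_boot all_order all_algebra.
From mathcomp Require Import complex.
From mathcomp Require Import all_classical all_reals all_analysis.
Import GRing.Theory Num.Theory.
Import numFieldNormedType.Exports.
Local Open Scope classical_set_scope.
Local Open Scope ring_scope.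

Set Implicit Arguments.
Unset Strict Implicit.
Unset Printing Implicit Defensive.

(** Neither Zariski density nor generic smoothness is invoked: genericity is tested on polynomial
    curves in one parameter, where it means that a nonzero polynomial does not vanish. Two points
    are joined by a line, so an open condition known at one end and another known at the other end
    hold together at some parameter. The tangent argument rests on Cramer's rule: where the rank of
    a linear system is maximal, a solution extends to a polynomial family of solutions, and
    comparing first-order terms replaces differentiation. Polynomial families forbid division, hence
    the scalar that clears denominators when a representation is restricted to a moving kernel. The
    plain rank of [Phi] would not control how its kernel and image meet the filtrations, so the
    ranks of [Phi] on the steps of [F] and modulo the steps of [G] are maximised in one sum.
    Completeness of the filtrations gives bases with one vector per jump, so jump sets determine
    Borel orbits. Limits are taken by saturating an explicit matrix, in place of the compactness of
    the Grassmannian. *)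

Section Linear.
Variable (K : fieldType).
Implicit Types E : vectType K.

Lemma lfun_exists E E' (f : E -> E') :
  linear f -> exists g : 'Hom(E, E'), forall u, g u = f u.
Proof.
move=> f_lin.
pose F : {linear E -> E'} := HB.pack f (GRing.isLinear.Build _ _ _ _ f f_lin).
by exists (linfun F) => u; rewrite lfunE.
Qed.

Lemma dirsum_sumE (I : finType) (E : I -> vectType K) J (r : seq J)
    (f : J -> dirsum E) i : (\sum_(j <- r) f j) i = \sum_(j <- r) f j i.
Proof.
elim: r => [|j r IHr]; first by rewrite !big_nil ffunE.
by rewrite !big_cons dirsumDE IHr.
Qed.

End Linear.

(** * Polynomial curves *)

Section Curves.
Variable (k : numFieldType).
Implicit Types E : vectType (k : fieldType).

(** The exceptional set is finite and is witnessed by a polynomial, so that conjunctions become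
    products and the nonvanishing of a minor is directly of this form. *)
Definition generically (P : k -> Prop) :=
  exists2 p : {poly k}, p != 0 & forall t, p.[t] != 0 -> P t.

Lemma generically_mono (P P' : k -> Prop) :
  (forall t, P t -> P' t) -> generically P -> generically P'.
Proof. by move=> PP' [p p0 pP]; exists p => // t /pP /PP'. Qed.

Lemma generically_all (P : k -> Prop) : (forall t, P t) -> generically P.
Proof. by move=> PT; exists 1 => //; exact: oner_neq0. Qed.

Lemma generically_and (P P' : k -> Prop) :
  generically P -> generically P' -> generically (fun t => P t /\ P' t).
Proof.
move=> [p p0 pP] [q q0 qP]; exists (p * q); first by rewrite mulf_neq0.
by move=> t; rewrite hornerM mulf_eq0 negb_or => /andP[/pP ? /qP ?].
Qed.

Lemma generically_forall (I : finType) (P : I -> k -> Prop) :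
  (forall i, generically (P i)) -> generically (fun t => forall i, P i t).
Proof.
move=> Pgen.
have /choice[p pP] i : exists p : {poly k},
    p != 0 /\ forall t, p.[t] != 0 -> P i t.
  by have [p] := Pgen i; exists p.
exists (\prod_i p i); first by apply/prodf_neq0 => i _; case: (pP i).
move=> t; rewrite horner_prod => /prodf_neq0 nz i; apply: (pP i).2.
exact: nz.
Qed.

Lemma generically_ex (P : k -> Prop) : generically P -> exists t, P t.
Proof.
move=> [p p0 pP]; apply: contrapT => noP.
(* In characteristic 0 these are more distinct scalars than [p] can have roots. *)
pose l : seq k := [seq n%:R | n <- iota 0 (size p).+1].
have ul : uniq l.
  rewrite map_inj_uniq ?iota_uniq// => m n /eqP.
  by rewrite eqr_nat => /eqP.
have := max_poly_roots p0 _ ul; rewrite size_map size_iota.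
have -> : all (root p) l.
  apply/allP => t _; rewrite /root; apply: contrapT => /negP nz.
  by apply: noP; exists t; apply: pP.
by move=> /(_ isT); rewrite ltnNge leqnSn.
Qed.

Lemma generically_neq (t0 : k) : generically (fun t => t != t0).
Proof.
exists ('X - t0%:P); first by rewrite polyXsubC_eq0.
by move=> t; rewrite hornerXsubC subr_eq0.
Qed.

Lemma root_avoid (p : {poly k}) : (forall t, p.[t] = 0) -> p = 0.
Proof.
move=> p0; apply/eqP; apply: contrapT => /negP pn0.
have [] : exists t : k, False; last by [].
by apply: generically_ex; exists p => // t; rewrite p0 eqxx.
Qed.

Definition polyfun (f : k -> k) := exists p : {poly k}, forall t, f t = p.[t].

Lemma polyfun_neq0 f t0 : polyfun f -> f t0 != 0 -> generically (fun t => f t != 0).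
Proof.
move=> [p fp] ft0; exists p; last by move=> t; rewrite fp.
by apply: contraNneq ft0 => p0; rewrite fp p0 horner0.
Qed.

Lemma polyfun_cst c : polyfun (fun=> c).
Proof. by exists c%:P => t; rewrite hornerC. Qed.

Lemma polyfunM f g : polyfun f -> polyfun g -> polyfun (fun t => f t * g t).
Proof. by move=> [p fp] [q gq]; exists (p * q) => t; rewrite hornerM fp gq. Qed.

Lemma polyfun_mx m n (M : k -> 'M[k]_(m, n)) :
  (forall i j, polyfun (fun t => M t i j)) ->
  exists P : 'M[{poly k}]_(m, n), forall t, M t = map_mx (horner_eval t) P.
Proof.
move=> Mpol.
have /choice[P MP] : forall ij : 'I_m * 'I_n, exists p : {poly k}, forall t,
    M t ij.1 ij.2 = p.[t] by move=> [i j]; exact: Mpol.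
exists (\matrix_(i, j) P (i, j)) => t.
by apply/matrixP => i j; rewrite !mxE horner_evalE -(MP (i, j)).
Qed.

Lemma polyfun_det n (M : k -> 'M[k]_n) :
  (forall i j, polyfun (fun t => M t i j)) -> polyfun (fun t => \det (M t)).
Proof.
by move=> /polyfun_mx[P MP]; exists (\det P) => t; rewrite MP det_map_mx.
Qed.

Lemma polyfun_adj n (M : k -> 'M[k]_n) i j :
  (forall i j, polyfun (fun t => M t i j)) -> polyfun (fun t => (\adj (M t)) i j).
Proof.
move=> /polyfun_mx[P MP]; exists ((\adj P) i j) => t.
by rewrite MP -map_mx_adj mxE.
Qed.

Definition polycurve E (g : k -> E) :=
  exists (n : nat) (a : nat -> E), forall t, g t = \sum_(i < n) t ^+ i *: a i.

Lemma eq_polycurve E (g h : k -> E) : g =1 h -> polycurve g -> polycurve h.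
Proof. by move=> gh [n [a ga]]; exists n, a => t; rewrite -gh. Qed.

Lemma polycurve_cst E (u : E) : polycurve (fun=> u).
Proof. by exists 1%N, (fun=> u) => t; rewrite big_ord1 expr0 scale1r. Qed.

Lemma polycurveD E (g h : k -> E) :
  polycurve g -> polycurve h -> polycurve (fun t => g t + h t).
Proof.
move=> [n [a ga]] [m [b hb]].
have pad q (c : nat -> E) (M : nat) (t : k) : (q <= M)%N ->
    \sum_(i < q) t ^+ i *: c i
    = \sum_(i < M) t ^+ i *: (if (i < q)%N then c i else 0).
  move=> qM; rewrite (big_ord_widen M (fun i => t ^+ i *: c i))// big_mkcond.
  by apply: eq_bigr => i _; case: ifP => // _; rewrite scaler0.
exists (maxn n m), (fun i => (if (i < n)%N then a i else 0)
                             + (if (i < m)%N then b i else 0)) => t.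
rewrite ga hb (pad n a (maxn n m)) ?leq_maxl// (pad m b (maxn n m)) ?leq_maxr//.
by rewrite -big_split; apply: eq_bigr => i _; rewrite scalerDr.
Qed.

Lemma polycurve_sum E (I : Type) (r : seq I) (g : I -> k -> E) :
  (forall i, polycurve (g i)) -> polycurve (fun t => \sum_(i <- r) g i t).
Proof.
move=> gp; elim: r => [|i r IHr].
  by apply: eq_polycurve (polycurve_cst 0) => t; rewrite big_nil.
by apply: eq_polycurve (polycurveD (gp i) IHr) => t; rewrite big_cons.
Qed.

Lemma polycurve_lin E E' (f : {linear E -> E'}) (g : k -> E) :
  polycurve g -> polycurve (fun t => f (g t)).
Proof.
move=> [n [a ga]]; exists n, (f \o a) => t; rewrite ga linear_sum.
by apply: eq_bigr => i _; rewrite linearZ.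
Qed.

Lemma polyfun_lin E (f : {scalar E}) (g : k -> E) :
  polycurve g -> polyfun (fun t => f (g t)).
Proof.
move=> [n [a ga]]; exists (\poly_(i < n) f (a i)) => t.
rewrite ga linear_sum horner_poly.
by apply: eq_bigr => i _; rewrite linearZ /= mulrC.
Qed.

Lemma polycurveZX E (g : k -> E) : polycurve g -> polycurve (fun t => t *: g t).
Proof.
move=> [n [a ga]]; exists n.+1, (fun i => if i is j.+1 then a j else 0) => t.
rewrite big_ord_recl /= scaler0 add0r ga scaler_sumr.
by apply: eq_bigr => i _; rewrite scalerA -exprS.
Qed.

Lemma polycurveZXn E (g : k -> E) n :
  polycurve g -> polycurve (fun t => t ^+ n *: g t).
Proof.
elim: n => [|n IHn] gp; first by apply: eq_polycurve gp => t; rewrite expr0 scale1r.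
by apply: eq_polycurve (polycurveZX (IHn gp)) => t; rewrite scalerA exprS.
Qed.

Lemma polycurveZ E f (g : k -> E) :
  polyfun f -> polycurve g -> polycurve (fun t => f t *: g t).
Proof.
move=> [p fp] gp.
apply: eq_polycurve (polycurve_sum (index_enum 'I_(size p)) (g := fun i t =>
   t ^+ i *: (p`_i *: g t)) _) => [t|i] /=.
  rewrite fp horner_coef scaler_suml; apply: eq_bigr => i _.
  by rewrite scalerA mulrC.
exact/polycurveZXn/(polycurve_lin ( *:%R _)).
Qed.

Lemma polycurveN E (g : k -> E) : polycurve g -> polycurve (fun t => - g t).
Proof. exact: (polycurve_lin -%R). Qed.

Lemma polycurveB E (g h : k -> E) :
  polycurve g -> polycurve h -> polycurve (fun t => g t - h t).
Proof. by move=> gp hp; apply/polycurveD/polycurveN. Qed.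

Lemma polycurve_line E (u v : E) : polycurve (fun t => u + t *: v).
Proof. exact: polycurveD (polycurve_cst u) (polycurveZX (polycurve_cst v)). Qed.

(** The polynomial ring is a domain, so each coordinate of [g] vanishes once its product with [p]
    does. This carries identities proved at generic parameters over to the special ones. *)
Lemma polycurve_eq0 E (g : k -> E) :
  polycurve g -> generically (fun t => g t = 0) -> forall t, g t = 0.
Proof.
move=> gp [p p0 pg] t.
rewrite (coord_vbasis (memvf (g t))); apply: big1 => i _.
have [q gq] := polyfun_lin (coord (vbasis fullv) i) gp.
have pq0 : p * q = 0.
  apply: root_avoid => s; rewrite hornerM -gq; apply/eqP.
  by rewrite mulf_eq0; case: eqVneq => //= /pg ->; rewrite linear0.
move/eqP: pq0; rewrite mulf_eq0 (negPf p0) /= => /eqP q0.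
by rewrite gq q0 horner0 scale0r.
Qed.

(** The curve [h] is the difference quotient of [g] at 0, and [h 0] is the tangent vector. *)
Lemma polycurve_deriv E (g : k -> E) :
  polycurve g -> exists2 h, polycurve h & forall t, g t = g 0 + t *: h t.
Proof.
move=> [n [a ga]].
exists (fun t => \sum_(i < n.-1) t ^+ i *: a i.+1); first by exists n.-1, (fun i => a i.+1).
move=> t; rewrite !ga; case: n {ga} => [|n] /=; first by rewrite !big_ord0 scaler0 addr0.
rewrite !big_ord_recl !expr0 !scale1r [X in _ + X + _]big1 => [|i _].
  rewrite addr0; congr (_ + _); rewrite scaler_sumr.
  by apply: eq_bigr => i _; rewrite scalerA exprS.
by rewrite exprS mul0r scale0r.
Qed.

Lemma polycurve_lfun E E' (A : k -> 'Hom(E, E')) :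
  (forall u, polycurve (fun t => A t u)) -> polycurve A.
Proof.
move=> Ap.
(* [L w] is the rank-one map given by the [i]-th coordinate form and [w]; [A t] is the sum of the
   rank-one maps with [w] its value at the [i]-th basis vector. *)
have elem i : exists L : 'Hom(E', 'Hom(E, E')), forall w u,
    L w u = coord (vbasis fullv) i u *: w.
  have /choice[L0 L0E] : forall w : E', exists f : 'Hom(E, E'), forall u,
      f u = coord (vbasis fullv) i u *: w.
    move=> w; apply: lfun_exists => c u v.
    by rewrite linearP scalerDl scalerA.
  have [|L LE] := @lfun_exists _ _ _ L0.
    move=> c u v; apply/lfunP => z.
    by rewrite add_lfunE scale_lfunE !L0E scalerDr !scalerA mulrC.
  by exists L => w u; rewrite LE L0E.
have /choice[L LE] := elem.
apply: eq_polycurve (polycurve_sum (index_enum _) (g := fun i t =>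
   L i (A t (vbasis fullv)`_i)) _) => [t|i] /=.
  apply/lfunP => u; rewrite sum_lfunE [in RHS](coord_vbasis (memvf u)) linear_sum.
  by apply: eq_bigr => i _; rewrite LE linearZ.
exact: (polycurve_lin (L i)) (Ap _).
Qed.

Lemma polycurve_app E E' (A : k -> 'Hom(E, E')) (g : k -> E) :
  polycurve A -> polycurve g -> polycurve (fun t => A t (g t)).
Proof.
move=> Ap gp; have [n [a gE]] := gp.
apply: eq_polycurve (polycurve_sum (index_enum 'I_n) (g := fun i t =>
   t ^+ i *: A t (a i)) _) => [t|i] /=.
  by rewrite gE linear_sum; apply: eq_bigr => i _; rewrite linearZ.
apply: polycurveZXn; have [m [B AB]] := Ap; exists m, (fun j => B j (a i)) => t.
by rewrite AB sum_lfunE; apply: eq_bigr => j _; rewrite scale_lfunE.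
Qed.

Lemma polycurve_comp E E' E'' (A : k -> 'Hom(E', E'')) (B : k -> 'Hom(E, E')) :
  polycurve A -> polycurve B -> polycurve (fun t => (A t \o B t)%VF).
Proof.
move=> Ap Bp; apply: polycurve_lfun => u.
apply: eq_polycurve (polycurve_app Ap (polycurve_app Bp (polycurve_cst u))) => t.
by rewrite comp_lfunE.
Qed.

Lemma polycurve_dirsum (I : finType) (E : I -> vectType (k : fieldType)) (g : k -> dirsum E) :
  (forall i, polycurve (fun t => g t i)) -> polycurve g.
Proof.
move=> gp; have /choice[n nP] : forall i, exists n : nat, exists a : nat -> E i,
  forall t, g t i = \sum_(j < n) t ^+ j *: a j by exact: gp.
pose N := (\sum_i n i)%N.
have nN i : (n i <= N)%N by rewrite /N (bigD1 i) //= leq_addr.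
have ex i : exists a : nat -> E i, forall t, g t i = \sum_(j < N) t ^+ j *: a j.
  have [a aP] := nP i; exists (fun j => if (j < n i)%N then a j else 0) => t.
  rewrite aP (big_ord_widen N (fun i => t ^+ i *: a i))// big_mkcond.
  by apply: eq_bigr => j _; case: ifP => // _; rewrite scaler0.
pose a i := projT1 (cid (ex i)).
exists N, (fun j => [ffun i => a i j : E i] : dirsum E) => t.
apply/ffunP => i; rewrite dirsum_sumE (projT2 (cid (ex i)) t).
by apply: eq_bigr => j _; rewrite dirsumZE ffunE.
Qed.

Lemma polycurve_coord (I : finType) (E : I -> vectType (k : fieldType)) (g : k -> dirsum E) i :
  polycurve g -> polycurve (fun t => g t i).
Proof.
move=> [n [a ga]]; exists n, (fun j => a j i) => t.
by rewrite ga dirsum_sumE; apply: eq_bigr => j _; rewrite dirsumZE.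
Qed.

(* [hom_sum] and [rep_sum] unfold to [dirsum], but comparing their vector space
   structures with that of [dirsum] is expensive: it is done here once. *)
Section QuiverCurves.
Variables (Q : quiver) (V W : vertex Q -> vectType (k : fieldType)).

Lemma polycurve_hom (g : k -> hom_sum V W) :
  (forall x, polycurve (fun t => g t x)) -> polycurve g.
Proof. exact: polycurve_dirsum. Qed.

Lemma polycurve_hom_coord (g : k -> hom_sum V W) x :
  polycurve g -> polycurve (fun t => g t x).
Proof. exact: polycurve_coord. Qed.

Lemma polycurve_rep (g : k -> rep_sum V W) :
  (forall a, polycurve (fun t => g t a)) -> polycurve g.
Proof. exact: polycurve_dirsum. Qed.

Lemma polycurve_rep_coord (g : k -> rep_sum V W) a :
  polycurve g -> polycurve (fun t => g t a).
Proof. exact: polycurve_coord. Qed.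

Lemma polycurve_rep_line (u v : rep_sum V W) : polycurve (fun t => u + t *: v).
Proof. exact: (@polycurve_line (rep_sum V W)). Qed.

Lemma polycurve_rep_cst (u : rep_sum V W) : polycurve (fun=> u).
Proof. exact: polycurve_cst. Qed.

Lemma polycurve_hom_cst (u : hom_sum V W) : polycurve (fun=> u).
Proof. exact: polycurve_cst. Qed.

End QuiverCurves.

End Curves.

(** * Ranks along polynomial curves *)

Section RankCurves.
Variable (k : numFieldType).
Implicit Types E : vectType (k : fieldType).

Lemma rank_frame E E' (f : 'Hom(E, E')) (U : {vspace E}) :
  exists (u : 'I_(\dim (f @: U)%VS) -> E) (X : (\dim (f @: U)%VS).-tuple E'),
    [/\ forall i, u i \in U, free X & forall i, f (u i) = X`_i].
Proof.
pose X := vbasis (f @: U)%VS.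
have Xf : free X := basis_free (vbasisP _).
have /choice[u uP] : forall i : 'I_(\dim (f @: U)%VS),
    exists u : E, u \in U /\ f u = X`_i.
  move=> i; have /memv_imgP[w wU ->] : X`_i \in (f @: U)%VS.
    by apply: vbasis_mem; apply: mem_nth; rewrite size_tuple.
  by exists w.
by exists u, X; split=> // i; case: (uP i).
Qed.

(** When [u] and [X] come from [rank_frame] for [f], this is a maximal minor of [f] normalised to
    the identity; where its determinant at [g] is nonzero, [g] has rank at least [r]. *)
Definition gram E E' (g : 'Hom(E, E')) r (u : 'I_r -> E) (X : r.-tuple E') :=
  \matrix_(i, j) coord X j (g (u i)).

Lemma gram_frame E E' (f : 'Hom(E, E')) r (u : 'I_r -> E) (X : r.-tuple E') :
  free X -> (forall i, f (u i) = X`_i) -> gram f u X = 1%:M.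
Proof.
by move=> Xf fu; apply/matrixP => i j; rewrite !mxE fu coord_free.
Qed.

Lemma gram_inj E E' (g : 'Hom(E, E')) r (u : 'I_r -> E) (X : r.-tuple E')
    (y : 'rV_r) : \det (gram g u X) != 0 ->
  (forall j, coord X j (\sum_i y 0 i *: g (u i)) = 0) -> y = 0.
Proof.
move=> Dn0 y0; have yN : y *m gram g u X = 0.
  apply/rowP => j; rewrite !mxE -[RHS](y0 j) linear_sum.
  by apply: eq_bigr => i _; rewrite mxE linearZ.
move: Dn0; rewrite -unitfE -unitmxE => Nu.
by rewrite -(mulmxK Nu y) yN mul0mx.
Qed.

Lemma gram_free E E' (g : 'Hom(E, E')) r (u : 'I_r -> E) (X : r.-tuple E') :
  \det (gram g u X) != 0 -> free [tuple g (u i) | i < r].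
Proof.
move=> Dn0; apply/freeP => c c0 i.
have := @gram_inj _ _ _ _ _ _ (\row_i c i) Dn0; move=> H.
suff /rowP/(_ i) : \row_i c i = 0 by rewrite !mxE.
apply: H => j; rewrite (eq_bigr (fun i : 'I_r => c i *: [tuple g (u i) | i < r]`_i)).
  by rewrite c0 linear0.
by move=> l _; rewrite mxE -tnth_nth tnth_mktuple.
Qed.

Lemma gram_span E E' (g : 'Hom(E, E')) (U : {vspace E}) r (u : 'I_r -> E) :
  (forall i, u i \in U) -> (<<[tuple g (u i) | i < r]>> <= g @: U)%VS.
Proof.
move=> uU; apply/span_subvP => _ /mapP[i _ ->]; exact: memv_img.
Qed.

Lemma gram_dim E E' (g : 'Hom(E, E')) (U : {vspace E}) r (u : 'I_r -> E)
    (X : r.-tuple E') : (forall i, u i \in U) ->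
  \det (gram g u X) != 0 -> (r <= \dim (g @: U)%VS)%N.
Proof.
move=> uU Dn0; have := gram_free Dn0; rewrite /free size_tuple => /eqP <-.
exact/dimvS/gram_span.
Qed.

Lemma polyfun_gram E E' (A : k -> 'Hom(E, E')) r (u : 'I_r -> E)
    (X : r.-tuple E') i j :
  polycurve A -> polyfun (fun t => gram (A t) u X i j).
Proof.
move=> Ap; have [p pP] := polyfun_lin (coord X j) (polycurve_app Ap (polycurve_cst (u i))).
by exists p => t; rewrite mxE pP.
Qed.

Lemma rank_semicontinuous E E' (A : k -> 'Hom(E, E')) (U : {vspace E}) t0 :
  polycurve A -> generically (fun t => \dim (A t0 @: U)%VS <= \dim (A t @: U)%VS)%N.
Proof.
move=> Ap; have [u [X [uU Xf AuX]]] := rank_frame (A t0) U.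
have Dp : polyfun (fun t => \det (gram (A t) u X)).
  by apply: polyfun_det => i j; exact: polyfun_gram.
have : \det (gram (A t0) u X) != 0 by rewrite gram_frame// det1 oner_neq0.
by move=> /(polyfun_neq0 Dp); apply: generically_mono => t; exact: gram_dim.
Qed.

(* Cramer's rule on a maximal nonzero minor of [A 0] deforms a kernel vector. *)
Lemma kernel_deformation E E' (A : k -> 'Hom(E, E')) (U : {vspace E}) x :
  polycurve A ->
  generically (fun t => \dim (A t @: U)%VS <= \dim (A 0 @: U)%VS)%N ->
  x \in U -> A 0 x = 0 ->
  exists y : k -> E, [/\ polycurve y, y 0 = x, forall t, y t \in U
                       & forall t, A t (y t) = 0].
Proof.
move=> Ap Amax xU Ax0; have [u [X [uU Xf AuX]]] := rank_frame (A 0) U.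
pose N t := gram (A t) u X; pose c t := \row_j coord X j (A t x).
have Np i j : polyfun (fun t => N t i j) by exact: polyfun_gram.
have Dp : polyfun (fun t => \det (N t)) by exact: polyfun_det.
have N0 : N 0 = 1%:M by exact: gram_frame.
pose y t := \det (N t) *: x - \sum_i (c t *m \adj (N t)) 0 i *: u i.
have cp j : polyfun (fun t => coord X j (A t x)).
  by apply: polyfun_lin; apply: polycurve_app Ap (polycurve_cst x).
have yp : polycurve y.
  apply: polycurveB; first exact: polycurveZ Dp (polycurve_cst x).
  apply: polycurve_sum => i; apply: polycurveZ (polycurve_cst _).
  have fs (J : Type) (r : seq J) (f : J -> k -> k) :
      (forall j, polyfun (f j)) -> polyfun (fun t => \sum_(j <- r) f j t).
    move=> fp; elim: r => [|j r [p IHr]].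
      by exists 0 => t; rewrite big_nil horner0.
    have [q fq] := fp j.
    by exists (q + p) => t; rewrite big_cons hornerD fq IHr.
  have [p pP] := fs _ (index_enum 'I_(\dim (A 0 @: U)%VS)) (fun j t =>
     coord X j (A t x) * (\adj (N t)) j i)
     (fun j => polyfunM (cp j) (polyfun_adj j i Np)).
  by exists p => t; rewrite mxE -pP; apply: eq_bigr => j _; rewrite mxE.
have yU t : y t \in U.
  by rewrite rpredB ?rpredZ// rpred_sum// => i _; rewrite rpredZ.
exists y; split=> //.
  rewrite /y N0 det1 scale1r big1 ?subr0// => i _.
  suff -> : c 0 = 0 by rewrite mul0mx mxE scale0r.
  by apply/rowP => j; rewrite !mxE Ax0 linear0.
apply: (polycurve_eq0 (polycurve_app Ap yp)).
have Dgen : generically (fun t => \det (N t) != 0).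
  by apply: (polyfun_neq0 (t0 := 0)) => //; rewrite N0 det1 oner_neq0.
apply: generically_mono (generically_and Dgen Amax) => t [Dn0 Arank].
(* The rank bound makes the independent vectors [A t (u i)] span the whole image, so a vector of the
   image on which all the forms [coord X j] vanish is zero. Cramer's formula makes them vanish at
   [A t (y t)]. *)
have Aspan : <<[tuple (A t) (u i) | i < \dim (A 0 @: U)%VS]>>%VS = (A t @: U)%VS.
  apply/eqP; rewrite eqEdim gram_span//=.
  by have := gram_free Dn0; rewrite /free size_tuple => /eqP ->.
have : A t (y t) \in (A t @: U)%VS by exact: memv_img.
rewrite -Aspan => /coord_span yE.
pose z := \row_i coord [tuple A t (u i) | i < \dim (A 0 @: U)%VS] i (A t (y t)).
have yz : A t (y t) = \sum_i z 0 i *: A t (u i).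
  by rewrite {1}yE; apply: eq_bigr => i _; rewrite mxE -tnth_nth tnth_mktuple.
suff z0 : z = 0 by rewrite yz big1// => i _; rewrite z0 mxE scale0r.
apply: (gram_inj Dn0) => j; rewrite -yz /y linearB linearZ linear_sum /=.
rewrite linearB linearZ linear_sum /=.
have cN : (c t *m \adj (N t) *m N t) 0 j = \det (N t) * coord X j (A t x).
  by rewrite -mulmxA mul_adj_mx mul_mx_scalar !mxE.
rewrite -cN mxE -sumrB big1// => i _.
by rewrite linearZ linearZ /= [N t i j]mxE subrr.
Qed.

Lemma polycurve_mem E (g : k -> E) (U : {vspace E}) :
  polycurve g -> generically (fun t => g t \in U) -> forall t, g t \in U.
Proof.
move=> gp gU t; have gp' := polycurveB gp (polycurve_lin (projv U) gp).
suff /polycurve_eq0 - /(_ gp' t) /subr0_eq -> :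
    generically (fun t => g t - projv U (g t) = 0) by exact: memv_proj.
by apply: generically_mono gU => s gs; rewrite projv_id ?subrr.
Qed.

Lemma kernel_first_order E E' (A B : k -> 'Hom(E, E')) (y z : k -> E) :
  polycurve B -> polycurve z ->
  (forall t, A t = A 0 + t *: B t) -> (forall t, y t = y 0 + t *: z t) ->
  (forall t, A t (y t) = 0) -> A 0 (z 0) + B 0 (y 0) = 0.
Proof.
move=> Bp zp AB yz Ay0.
(* This curve is [A t (y t)] divided by [t]; its value at 0 is the product rule. *)
have gp : polycurve (fun t => A 0 (z t) + B t (y 0) + t *: B t (z t)).
  do ?apply: polycurveD.
  - exact: polycurve_app (polycurve_cst _) zp.
  - exact: polycurve_app Bp (polycurve_cst _).
  - exact: polycurveZX (polycurve_app Bp zp).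
have := polycurve_eq0 gp _ 0; rewrite scale0r addr0; apply.
apply: generically_mono (generically_neq 0) => t tn0.
apply: (scalerI tn0); rewrite scaler0.
have := Ay0 t; rewrite (AB t) (yz t) add_lfunE scale_lfunE.
rewrite !(linearD (A 0)) !(linearD (B t)) !linearZ /=.
by rewrite Ay0 add0r !scalerDr addrA.
Qed.

(** This is the tangent condition for determinantal loci: the kernel vector deforms along the curve,
    and the first-order part of [A t (y t) = 0] writes [B 0 x] as minus the image under [A 0] of the
    tangent of [y]. *)
Lemma kernel_deriv_image E E' (A B : k -> 'Hom(E, E')) (U : {vspace E}) x :
  polycurve B -> (forall t, A t = A 0 + t *: B t) ->
  generically (fun t => \dim (A t @: U)%VS <= \dim (A 0 @: U)%VS)%N ->
  x \in U -> A 0 x = 0 -> B 0 x \in (A 0 @: U)%VS.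
Proof.
move=> Bp AB Amax xU Ax0.
have Ap : polycurve A.
  have := polycurveD (polycurve_cst (A 0)) (polycurveZX Bp).
  by apply: eq_polycurve => t; rewrite -AB.
have [y [yp y0 yU Ay]] := kernel_deformation Ap Amax xU Ax0.
have [z zp yz] := polycurve_deriv yp.
have zU : z 0 \in U.
  apply: (polycurve_mem zp); apply: generically_mono (generically_neq 0) => t tn0.
  suff -> : z t = t^-1 *: (y t - y 0) by rewrite rpredZ// rpredB.
  by rewrite yz addrC addKr scalerA mulVf// scale1r.
have := kernel_first_order Bp zp AB yz Ay; rewrite y0 => /eqP.
by rewrite addr_eq0 => /eqP AzB; rewrite -[B 0 x]opprK -AzB rpredN memv_img.
Qed.

End RankCurves.

(** * Filtrations and adapted bases *)

Section Adapted.
Variable (K : fieldType).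
Implicit Types E : vectType K.

Lemma filtration_mono E l (F : 'I_l.+1 -> {vspace E}) :
  complete_filtration F -> {homo F : i j / (i <= j)%N >-> (i <= j)%VS}.
Proof.
move=> [_ _ Fstep] i j ij.
suff H n (jn : (i + n < l.+1)%N) : (F i <= F (Ordinal jn))%VS.
  have jn : (i + (j - i) < l.+1)%N by rewrite subnKC.
  by rewrite (_ : j = Ordinal jn) //; apply: val_inj; rewrite /= subnKC.
elim: n jn => [|n IHn] jn.
  by rewrite (_ : Ordinal jn = i)//; apply: val_inj; rewrite /= addn0.
have jn' : (i + n < l.+1)%N by apply: ltn_trans jn; rewrite addnS.
apply: subv_trans (IHn jn') _; apply: (Fstep _ _ _).1.
by rewrite /= addnS.
Qed.

(** A step raises the dimension by at most one, so at each jump a single vector outside the previous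
    term completes a basis. *)
Lemma chain_sum_span E (l : nat) (H : nat -> {vspace E}) (J : nat -> bool)
    (e : nat -> E) : H 0 = 0%VS ->
  (forall n, (n < l)%N -> (H n <= H n.+1)%VS /\ (\dim (H n.+1) <= (\dim (H n)).+1)%N) ->
  J 0 = false -> (forall n, (n < l)%N -> J n.+1 = (\dim (H n) < \dim (H n.+1))%N) ->
  (forall n, (n < l)%N -> J n.+1 -> e n.+1 \in H n.+1 /\ e n.+1 \notin H n) ->
  forall n, (n <= l)%N ->
    H n = (\sum_(i < n.+1) if J i then <[e i]> else 0)%VS
    /\ \dim (H n) = (\sum_(i < n.+1) J i)%N.
Proof.
move=> H0 Hstep J0 JS eP; elim=> [|n IHn] nl.
  by rewrite !big_ord1 J0 H0 dimv0.
have [Hn dHn] := IHn (ltnW nl); have [HS dHS] := Hstep n nl.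
rewrite big_ord_recr [X in _ /\ _ = X]big_ord_recr /= -Hn -dHn JS//.
case: ltnP => [dlt|dge].
  have Jn : J n.+1 by rewrite JS.
  have [eH eH'] := eP n nl Jn.
  have eq : (H n + <[e n.+1]>)%VS = H n.+1.
    apply/eqP; rewrite eqEdim subv_add HS -memvE eH /=.
    apply: leq_trans dHS _; rewrite ltnNge; apply/negP => le.
    have : (H n + <[e n.+1]> <= H n)%VS.
      by rewrite -(geq_leqif (dimv_leqif_sup (addvSl _ _))).
    by rewrite subv_add -memvE (negPf eH') andbF.
  split=> //; apply/eqP; rewrite eqn_leq addn1 dHS /=; exact: dlt.
rewrite addv0 addn0; suff -> : H n.+1 = H n by [].
by apply/esym/eqP; rewrite eqEdim HS.
Qed.

(** The set of jumps is the Schubert position of [S] relative to [F]. Index 0 compares a space with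
    itself and is never a jump. *)
Definition jump E l (F : 'I_l.+1 -> {vspace E}) (S : {vspace E}) (i : nat) : bool :=
  (\dim (F (inord i.-1) :&: S) < \dim (F (inord i) :&: S))%N.

(** A basis compatible with [F] and [S] at once, indexed by the steps of [F] and padded with zero
    vectors where [F] does not grow, together with its coordinate forms [c]. The vectors at the
    jumps of [S] form a basis of [S]. *)
Structure adapted E l (F : 'I_l.+1 -> {vspace E}) (S : {vspace E})
    (e : 'I_l.+1 -> E) (c : 'I_l.+1 -> 'Hom(E, K^o)) : Prop := Adapted {
  adapted_sum : forall v, v = \sum_i c i v *: e i;
  adapted_mem : forall i, e i \in F i;
  adapted_filt : forall j v, v \in F j -> forall i : 'I_l.+1, (j < i)%N -> c i v = 0;
  adapted_dual : forall i j : 'I_l.+1, jump F fullv i -> c j (e i) = (j == i)%:R;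
  adapted_zero : forall i : 'I_l.+1, ~~ jump F fullv i -> e i = 0;
  adapted_sub : forall i : 'I_l.+1, jump F S i -> e i \in S;
  adapted_supp : forall v, v \in S -> forall i : 'I_l.+1, ~~ jump F S i -> c i v = 0 }.

Section OneFiltration.
Variables (E : vectType K) (l : nat) (F : 'I_l.+1 -> {vspace E}).
Hypothesis F_filtration : complete_filtration F.
Implicit Types S : {vspace E}.

Let H S n := (F (inord n) :&: S)%VS.

(** The sum of [F n] and the intersection of [F n.+1] with [S] stays inside [F n.+1], so the
    dimension formula for sums bounds the growth of the intersections by one. *)
Lemma filtration_step S n : (n < l)%N ->
  (H S n <= H S n.+1)%VS /\ (\dim (H S n.+1) <= (\dim (H S n)).+1)%N.
Proof.
move=> nl; have [_ _ Fstep] := F_filtration.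
have [|le dle] := Fstep (inord n) (inord n.+1).
  by rewrite !inordK// ltnS// ltnW.
split; first exact: capvS.
rewrite /H.
have := dimv_sum_cap (F (inord n)) (F (inord n.+1) :&: S)%VS.
rewrite capvA (capv_idPl le) => dsc.
have ub : (\dim (F (inord n) + F (inord n.+1) :&: S) <= (\dim (F (inord n))).+1)%N.
  apply: leq_trans dle; apply: dimvS; rewrite subv_add le /=; exact: capvSl.
by rewrite -(leq_add2l (\dim (F (inord n)))) -dsc addnS -addSn leq_add2r.
Qed.

Lemma jump0 S : jump F S 0 = false.
Proof. by rewrite /jump ltnn. Qed.

Lemma filtration_start S : H S 0 = 0%VS.
Proof.
have [F0 _ _] := F_filtration; rewrite /H (_ : inord 0 = ord0) ?F0 ?cap0v//.
by apply: val_inj; rewrite /= inordK.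
Qed.

Lemma dim_sum_jump S i : \dim (F i :&: S) = (\sum_(j < l.+1) (j <= i) * jump F S j)%N.
Proof.
have ex : exists e : nat -> E, forall n, (n < l)%N -> jump F S n.+1 ->
    e n.+1 \in H S n.+1 /\ e n.+1 \notin H S n.
  exists (fun n => vpick (H S n :\: H S n.-1)) => n nl J.
  have sub : vpick (H S n.+1 :\: H S n) \in (H S n.+1 :\: H S n)%VS by exact: memv_pick.
  split; first exact: subvP (diffvSl _ _) _ sub.
  apply/negP => mem.
  have : vpick (H S n.+1 :\: H S n) \in 0%VS.
    by rewrite -(capv_diff (H S n.+1) (H S n)) memv_cap sub mem.
  rewrite memv0 vpick0 diffv_eq0 => /dimvS; rewrite leqNgt; exact/negP/negPn.
have [e eP] := ex.
have il : (i <= l)%N by rewrite -ltnS.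
have [_] := chain_sum_span (filtration_start S) (filtration_step S) (jump0 S)
  (fun n _ => erefl) eP il.
rewrite /H inord_val => ->.
rewrite (big_ord_widen l.+1 (fun j => jump F S j : nat))// big_mkcond /=.
by apply: eq_bigr => j _; rewrite ltnS; case: ifP; rewrite ?mul1n.
Qed.

Lemma dim_sum_jumpT S : \dim S = (\sum_(j < l.+1) jump F S j)%N.
Proof.
have [_ FT _] := F_filtration.
rewrite -[in LHS](capfv S) -FT dim_sum_jump; apply: eq_bigr => j _.
by rewrite -ltnS ltn_ord mul1n.
Qed.

Lemma jump_full S i : (i < l.+1)%N -> jump F S i -> jump F fullv i.
Proof.
case: i => [|i] il; first by rewrite jump0.
have [le _] := filtration_step fullv il.
move=> J; rewrite /jump /= ltnNge; apply: contraL J => dle.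
have /eqP eq : H fullv i == H fullv i.+1 by rewrite eqEdim le.
rewrite /jump /= -leqNgt; move: eq; rewrite /H !capvf => ->.
exact: leqnn.
Qed.

Lemma adapted_exists S : exists e c, adapted F S e c.
Proof.
(* At a jump of [S] the new vector is chosen inside [S] but outside the previous step of [F], so it
   serves both chains. Where neither chain jumps, [vpick] of the zero space supplies the zero
   padding. *)
pose e (n : nat) : E := if jump F S n then vpick (H S n :\: H fullv n.-1)
                        else vpick (H fullv n :\: H fullv n.-1).
have vpickP (U V : {vspace E}) : ~~ (U <= V)%VS ->
    vpick (U :\: V) \in U /\ vpick (U :\: V) \notin V.
  move=> UV; have sub : vpick (U :\: V) \in (U :\: V)%VS by exact: memv_pick.
  split; first exact: subvP (diffvSl _ _) _ sub.
  apply/negP => mem; have : vpick (U :\: V) \in 0%VS.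
    by rewrite -(capv_diff U V) memv_cap sub mem.
  by rewrite memv0 vpick0 diffv_eq0 (negPf UV).
have eT n : (n < l)%N -> jump F fullv n.+1 ->
    e n.+1 \in H fullv n.+1 /\ e n.+1 \notin H fullv n.
  move=> nl J; rewrite /e; case: ifP => JS.
    have [|eH eH'] := vpickP (H S n.+1) (H fullv n).
      apply/negP => le; suff : (H S n.+1 <= H S n)%VS.
        by move=> /dimvS; rewrite leqNgt => /negP; apply.
      by rewrite subv_cap {1}/H capvSr andbT (subv_trans le)// capvSl.
    by split=> //; apply: subvP eH; exact: capvS (subvv _) (subvf _).
  apply: vpickP; apply/negP => /dimvS; rewrite leqNgt => /negP; exact.
have eS n : (n < l)%N -> jump F S n.+1 ->
    e n.+1 \in H S n.+1 /\ e n.+1 \notin H S n.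
  move=> nl J; have [_ eH'] := eT n nl (jump_full (i := n.+1) nl J).
  have [|eH _] := vpickP (H S n.+1) (H fullv n).
    apply/negP => le; suff : (H S n.+1 <= H S n)%VS.
      by move=> /dimvS; rewrite leqNgt => /negP; apply.
    by rewrite subv_cap {1}/H capvSr andbT (subv_trans le)// capvSl.
  rewrite {1}/e J; split=> //; apply: contra eH'; apply: subvP.
  exact: capvS (subvv _) (subvf _).
have e0 n : (n < l.+1)%N -> ~~ jump F fullv n -> e n = 0.
  case: n => [|n] nl J.
    rewrite /e jump0 /=; apply/eqP; rewrite vpick0 diffv_eq0; exact: subvv.
  rewrite /e (negPf (contra (@jump_full S _ nl) J)).
  apply/eqP; rewrite vpick0 diffv_eq0 /=.
  have [le _] := filtration_step fullv nl.
  by rewrite -(geq_leqif (dimv_leqif_sup le)) leqNgt.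
have spanT := chain_sum_span (filtration_start fullv) (filtration_step fullv)
  (jump0 fullv) (fun n _ => erefl) eT.
have spanS := chain_sum_span (filtration_start S) (filtration_step S)
  (jump0 S) (fun n _ => erefl) eS.
have [_ FT _] := F_filtration.
have Fl S' : H S' l = S'.
  by rewrite /H (_ : inord l = ord_max) ?FT ?capfv//; apply: val_inj; rewrite /= inordK.
pose L (i : 'I_l.+1) := <[e i]>%VS.
have sumL : (\sum_i L i)%VS = fullv.
  rewrite -(Fl fullv) (spanT l (leqnn l)).1; apply: eq_bigr => i _.
  by rewrite /L; case: ifP => // /negbT /e0 ->.
have dirL : directv (\sum_i L i)%VS.
  rewrite directvEgeq /= sumL -(Fl fullv) (spanT l (leqnn l)).2.
  apply: leq_sum => i _; rewrite /L dim_vline.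
  case: (boolP (jump F fullv i)) => [_|/(e0 _ (ltn_ord i)) ->]; first exact: leq_b1.
  by rewrite eqxx.
pose p i := sumv_pi_for (esym sumL) i.
have /choice[c cE] : forall i : 'I_l.+1, exists f : 'Hom(E, K^o),
    forall u, f u = coord [tuple e i] ord0 (p i u).
  by move=> i; apply: lfun_exists => a u v; rewrite !linearP.
have pe i v : p i v = c i v *: e i.
  have : p i v \in <<[tuple e i]>>%VS by rewrite span_seq1 memv_sum_pi.
  by move=> /coord_span {1}->; rewrite big_ord1 /= cE.
have sump v : \sum_i p i v = v by apply: sumv_pi_sum; exact: memvf.
have uniq_p (x : 'I_l.+1 -> E) v :
    (forall i, x i \in L i) -> v = \sum_i x i -> forall i, p i v = x i.
  move=> xL vx i; apply/eqP.
  have /directv_sum_unique/(_ (fun i => p i v) x) U := dirL.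
  have := U (fun i _ => memv_sum_pi _ i v) (fun i _ => xL i).
  by rewrite sump -vx eqxx => /esym/forallP/(_ i).
(* Used with the full space to get compatibility with the filtration, and with [S] at [ord_max] to
   get the support of vectors of [S]. *)
have supp S' (j : 'I_l.+1) v :
    (forall n, (n <= l)%N ->
      H S' n = (\sum_(i < n.+1) if jump F S' i then <[e i]> else 0)%VS
      /\ \dim (H S' n) = (\sum_(i < n.+1) jump F S' i)%N) ->
    v \in H S' j ->
    forall i : 'I_l.+1, ~~ ((i <= j)%N && jump F S' i) -> c i v = 0.
  move=> span; have jl : (j <= l)%N by rewrite -ltnS.
  rewrite (span j jl).1.
  rewrite (big_ord_widen l.+1 (fun i => if jump F S' i then <[e i]> else 0)%VS)//.
  rewrite big_mkcond /= => /memv_sumP[x xP vx] i iP.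
  have -> : c i v = coord [tuple e i] ord0 (p i v) by rewrite cE.
  rewrite (uniq_p x v)// => [|i'].
    have := xP i isT; rewrite ltnS; move: iP.
    by case: leqP => _ /=; [move=> /negPf -> | move=> _];
       rewrite memv0 => /eqP ->; rewrite linear0.
  by have := xP i' isT; rewrite /L; case: ifP => _; [case: ifP => _ //|];
     rewrite memv0 => /eqP ->; exact: mem0v.
exists (fun i => e i), c; split.
- by move=> v; rewrite -[LHS]sump; apply: eq_bigr => i _; rewrite pe.
- move=> i; case: (boolP (jump F fullv i)) => [J|/e0 ->//]; last exact: mem0v.
  case: i J => [[|i] il] J; first by move: J; rewrite jump0.
  have [] := eT i il J; rewrite /H capvf => + _.
  by congr (_ \in F _); apply: val_inj; rewrite /= inordK.
- move=> j v vF i ji; apply: (supp fullv j) => //.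
    by rewrite /H inord_val capvf.
  by rewrite leqNgt ji.
- move=> i j J.
  have en0 : e i != 0.
    case: i J => [[|i] il] J; first by move: J; rewrite jump0.
    have [_] := eT i il J; apply: contraNneq => ->; exact: mem0v.
  have := uniq_p (fun j => if j == i then e i else 0) (e i).
  have -> : c j (e i) = coord [tuple e j] ord0 (p j (e i)) by rewrite cE.
  move=> ->.
  + have [ji|ji] := boolP (j == i); last by rewrite linear0.
    rewrite (eqP ji).
    rewrite -[X in coord _ _ X]/([tuple e i]`_(ord0 : 'I_1)) coord_free//.
    by rewrite seq1_free.
  + by move=> j'; case: eqVneq => [->|_]; rewrite /L ?memv_line ?mem0v.
  + by rewrite -big_mkcond big_pred1_eq.
- by move=> i /e0 ->.
- case=> [[|i] il] J; first by move: J; rewrite jump0.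
  by have [] := eS i il J; rewrite memv_cap => /andP[].
- move=> v vS i J; apply: (supp S ord_max) => //.
    by rewrite /H inord_val FT capfv.
  by rewrite (negPf J) andbF.
Qed.

End OneFiltration.

End Adapted.

(** * Dimension counts and Borel transitivity from adapted bases *)

Section AdaptedConsequences.
Variable (K : fieldType).
Implicit Types E : vectType K.

(** Among the subspaces contained in [P], one of maximal dimension absorbs the line of any further
    vector of [P]. *)
Lemma vspace_exists E (P : E -> Prop) : P 0 ->
  (forall a u v, P u -> P v -> P (a *: u + v)) ->
  exists U : {vspace E}, forall u, u \in U <-> P u.
Proof.
move=> P0 Plin.
pose D n := `[< exists2 U : {vspace E}, \dim U = n & forall u, u \in U -> P u >].
have exD : exists n, D n.
  by exists 0%N; apply/asboolP; exists 0%VS; rewrite ?dimv0// => u; rewrite memv0 => /eqP ->.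
have ubD n : D n -> (n <= \dim {:E})%N.
  by move=> /asboolP[U <- _]; exact/dimvS/subvf.
have [n /asboolP[U dU UP] nmax] := ex_maxnP exD ubD.
exists U => u; split=> [|Pu]; first exact: UP.
have /nmax : D (\dim (U + <[u]>)%VS).
  apply/asboolP; exists (U + <[u]>)%VS => // w /memv_addP[a /UP Pa [b /vlineP[c ->] ->]].
  by rewrite addrC; exact: Plin.
rewrite -dU => le; have := addvSl U <[u]>%VS.
move=> /dimv_leqif_sup/geq_leqif; rewrite le => /esym.
by rewrite subv_add -memvE => /andP[].
Qed.

Lemma lfun_scalars E E' l (c : 'I_l -> 'Hom(E, K^o)) (w : 'I_l -> E') :
  exists f : 'Hom(E, E'), forall v, f v = \sum_i c i v *: w i.
Proof.
apply: lfun_exists => a u v; rewrite scaler_sumr -big_split.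
by apply: eq_bigr => i _; rewrite linearP scalerDl scalerA.
Qed.

Lemma adapted_lfunE E E' l (F : 'I_l.+1 -> {vspace E}) S e c (f : 'Hom(E, E')) w (i : 'I_l.+1) :
  adapted F S e c -> (forall v, f v = \sum_i c i v *: w i) ->
  jump F fullv i -> f (e i) = w i.
Proof.
move=> ad fE J; rewrite fE (bigD1 i)//= (adapted_dual ad)// eqxx scale1r.
rewrite big1 ?addr0// => j ji.
by rewrite (adapted_dual ad)// (negPf ji) scale0r.
Qed.

Lemma sub_adapted E E' l (F : 'I_l.+1 -> {vspace E}) S e c (f : 'Hom(E, E'))
    (U : {vspace E'}) : adapted F S e c ->
  (f @: S <= U)%VS <-> forall i : 'I_l.+1, jump F S i -> f (e i) \in U.
Proof.
move=> ad; split=> [fSU i J|fU].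
  by apply: (subvP fSU); apply/memv_img/(adapted_sub ad).
apply/subvP => _ /memv_imgP[u uS ->].
rewrite (adapted_sum ad u) linear_sum rpred_sum// => i _; rewrite linearZ /=.
have [/fU|/(adapted_supp ad uS) ->] := boolP (jump F S i); first exact: rpredZ.
by rewrite scale0r mem0v.
Qed.

Lemma filt_adapted E E' l (F : 'I_l.+1 -> {vspace E}) (G : 'I_l.+1 -> {vspace E'})
    S e c (f : 'Hom(E, E')) :
  {homo G : i j / (i <= j)%N >-> (i <= j)%VS} -> adapted F S e c ->
  (forall i, f @: F i <= G i)%VS <-> forall i : 'I_l.+1, f (e i) \in G i.
Proof.
move=> Gmono ad; split=> [fFG i|fG i].
  by apply: (subvP (fFG i)); apply/memv_img/(adapted_mem ad).
apply/subvP => _ /memv_imgP[u uF ->].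
rewrite (adapted_sum ad u) linear_sum rpred_sum// => j _; rewrite linearZ /=.
have [ij|ij] := ltnP i j; first by rewrite (adapted_filt ad uF ij) scale0r mem0v.
by rewrite rpredZ//; apply: subvP (fG j); exact: Gmono.
Qed.

(** A family of maps is determined freely by its values on the nonzero basis vectors, so [X] is the
    direct sum of the [U a i] over the jumps. The index type [A] is arbitrary because both vertices
    and arrows occur. *)
Lemma dim_adapted_hom (A : finType) (V W : A -> vectType K) (l : A -> nat)
    (F : forall a, 'I_(l a).+1 -> {vspace V a}) S e c
    (U : forall a, 'I_(l a).+1 -> {vspace W a})
    (X : {vspace dirsum (fun a => 'Hom(V a, W a))}) :
  (forall a, adapted (@F a) (S a) (e a) (c a)) ->
  (forall Phi, Phi \in X <-> forall a i, Phi a (e a i) \in U a i) ->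
  \dim X = (\sum_a \sum_(i < (l a).+1) jump (@F a) fullv i * \dim (U a i))%N.
Proof.
move=> ad XP.
pose I := {a : A & 'I_(l a).+1}.
pose J (ai : I) := jump (@F (tag ai)) fullv (tagged ai).
pose Z (ai : I) := if J ai then U (tag ai) (tagged ai) else 0%VS.
pose D := dirsum (fun ai : I => (subvs_of (Z ai) : vectType K)).
pose M := dirsum (fun a => 'Hom(V a, W a)).
pose wd (d : D) a (i : 'I_(l a).+1) : W a :=
  vsval (d (Tagged (fun a => 'I_(l a).+1) i)).
have /choice[f fE] : forall d : D, exists Phi : M, forall a v,
    Phi a v = \sum_i c a i v *: wd d a i.
  move=> d.
  have ex a := lfun_scalars (c a) (wd d a).
  exists ([ffun a => projT1 (cid (ex a)) : 'Hom(V a, W a)] : M) => a v.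
  by rewrite ffunE (projT2 (cid (ex a))).
have [|g gE] := @lfun_exists _ _ _ f.
  move=> a u v; apply/ffunP => b; apply/lfunP => x.
  rewrite dirsumDE dirsumZE add_lfunE scale_lfunE !fE scaler_sumr -big_split.
  apply: eq_bigr => i _; have -> : wd (a *: u + v) b i = a *: wd u b i + wd v b i.
    by rewrite /wd dirsumDE dirsumZE.
  by rewrite scalerDr !scalerA [c b i x * a]mulrC.
have ge (d : D) (ai : I) : J ai -> g d (tag ai) (e _ (tagged ai)) = vsval (d ai).
  case: ai => a i Jai; rewrite gE; exact: (adapted_lfunE (ad a) (fE d a) Jai).
have Z0 (ai : I) : ~~ J ai -> (Z ai <= 0)%VS by rewrite /Z => /negPf ->.
have ZU (ai : I) : J ai -> (Z ai <= U (tag ai) (tagged ai))%VS by rewrite /Z => ->.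
have zero0 (ai : I) (d : D) : ~~ J ai -> d ai = 0.
  move=> nJ; apply: subvs_inj; have := subvP (Z0 _ nJ) _ (subvsP (d ai)).
  by rewrite memv0 => /eqP ->.
have ginj : lker g == 0%VS.
  apply/lker0P => d d' gdd'; apply/ffunP => ai.
  have [Jai|nJ] := boolP (J ai); last by rewrite !zero0.
  by apply: subvs_inj; rewrite -!ge// gdd'.
have gX : (limg g = X)%VS.
  apply/vspaceP => Phi; apply/memv_imgP/idP => [[d _ ->]|PhiX].
    apply/XP => a i; pose ai : I := Tagged (fun a => 'I_(l a).+1) i.
    have [Jai|nJ] := boolP (J ai).
      by rewrite (ge d ai Jai); exact: subvP (ZU _ Jai) _ (subvsP (d ai)).
    by rewrite (adapted_zero (ad a) nJ) linear0 mem0v.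
  exists ([ffun ai : I => vsproj (Z ai) (Phi (tag ai) (e _ (tagged ai)))
            : subvs_of (Z ai)] : D); first exact: memvf.
  apply/ffunP => a; apply/lfunP => v; rewrite gE fE.
  rewrite {1}(adapted_sum (ad a) v) linear_sum; apply: eq_bigr => i _.
  rewrite linearZ /= /wd ffunE /=.
  pose ai : I := Tagged (fun a => 'I_(l a).+1) i.
  rewrite -/ai.
  have [Jai|nJ] := boolP (J ai).
    congr (_ *: _); rewrite vsprojK// /Z Jai; exact: (XP _).1.
  rewrite (adapted_zero (ad a) nJ) linear0.
  have -> : vsproj (Z ai) 0 = 0 by exact: linear0.
  by rewrite linear0.
rewrite -gX (limg_dim_eq); last by rewrite capfv (eqP ginj).
rewrite dimvf {1}/dim /= card_tagged.
rewrite sumnE big_map big_enum /=.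
rewrite sig_big_dep /=.
apply: eq_bigr => ai _; rewrite card_ord.
have -> : dim (subvs_of (Z ai)) = \dim (Z ai) by [].
by rewrite /Z /J; case: ifP; rewrite ?mul1n// dimv0.
Qed.

Lemma dim_filtered_hom Q (V W : vertex Q -> vectType K) (l : vertex Q -> nat)
    (F : subspace_chain V l) (G : subspace_chain W l) :
  (forall x, complete_filtration (@F x)) ->
  (forall x, {homo @G x : i j / (i <= j)%N >-> (i <= j)%VS}) ->
  \dim (filtered_hom F G)
  = (\sum_x \sum_(i < (l x).+1) jump (@F x) fullv i * \dim (G x i))%N.
Proof.
move=> cF Gmono.
have ad x := cid (adapted_exists (cF x) fullv).
have ad' x := cid (projT2 (ad x)).
apply: (@dim_adapted_hom _ V W l F (fun=> fullv) (fun x => projT1 (ad x))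
  (fun x => projT1 (ad' x))) => [x|Phi]; first exact: (projT2 (ad' x)).
rewrite filtered_homP; split=> PhiP x.
  exact: (filt_adapted _ (Gmono x) (projT2 (ad' x))).1.
exact: (filt_adapted _ (Gmono x) (projT2 (ad' x))).2.
Qed.

Lemma dim_induced_chain Q (V : vertex Q -> vectType K) l (F : subspace_chain V l)
    (S : subfamily V) x i : \dim (induced_chain F S (x:=x) i) = \dim (F x i :&: S x).
Proof.
rewrite -induced_chainE limg_dim_eq//; apply/eqP; rewrite -subv0.
apply/subvP => u; rewrite memv_cap memv_ker lfunE memv0 => /andP[_ /eqP u0].
by apply/eqP/subvs_inj.
Qed.

Lemma jump_induced Q (V : vertex Q -> vectType K) l (F : subspace_chain V l)
    (S : subfamily V) x i : jump (@induced_chain _ _ _ _ F S x) fullv i = jump (@F x) (S x) i.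
Proof. by rewrite /jump !capvf !dim_induced_chain. Qed.

Lemma induced_filtration Q (V : vertex Q -> vectType K) l (F : subspace_chain V l)
    (S : subfamily V) x :
  complete_filtration (@F x) -> complete_filtration (@induced_chain _ _ _ _ F S x).
Proof.
move=> cF; have [F0 FT Fstep] := cF; split.
- by apply/eqP; rewrite -dimv_eq0 dim_induced_chain F0 cap0v dimv0.
- by apply/eqP; rewrite eqEdim subvf /= dim_induced_chain FT capfv dimvf.
- move=> i j ij.
  have [|] := filtration_step cF (S x) (n := i); first by rewrite -ltnS -ij.
  rewrite inord_val -ij inord_val -!dim_induced_chain => le dle; split=> //.
  apply/subvP => u; rewrite !mem_induced_chain; exact: subvP.
Qed.

(** Equal intersection dimensions mean equal jump sets, so the map matching a basis adapted to [S]
    with one adapted to [T], index by index, preserves [F] and carries [S] to [T]. *)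
Lemma same_position_borel E l (F : 'I_l.+1 -> {vspace E}) (S T : {vspace E}) :
  complete_filtration F -> (forall i, \dim (F i :&: S) = \dim (F i :&: T)) ->
  exists2 b : 'End(E), borel F b & (b @: S)%VS = T.
Proof.
move=> cF dST.
have [e [c ad]] := adapted_exists cF S; have [e' [c' ad']] := adapted_exists cF T.
have [b bE] := lfun_scalars c e'.
have be (i : 'I_l.+1) : jump F fullv i -> b (e i) = e' i by exact: (adapted_lfunE ad bE).
(* The coordinates of [v] are recovered from those of [b v], whence injectivity. *)
have cbi (i : 'I_l.+1) v : jump F fullv i -> c' i (b v) = c i v.
  move=> J.
  rewrite bE linear_sum (bigD1 i)//= linearZ /= (adapted_dual ad')// eqxx.
  rewrite big1 ?addr0 ?mulr1// => [|j ji]; first by rewrite /GRing.scale /= mulr1.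
  have [Jj|Jj] := boolP (jump F fullv j).
    by rewrite linearZ /= (adapted_dual ad')// eq_sym (negPf ji) scaler0.
  by rewrite (adapted_zero ad') // scaler0 linear0.
have b0 : lker b = 0%VS.
  apply/eqP; rewrite -subv0; apply/subvP => v; rewrite memv_ker memv0 => /eqP bv.
  rewrite (adapted_sum ad v) big1// => i _.
  have [J|J] := boolP (jump F fullv i); last by rewrite (adapted_zero ad)// scaler0.
  by rewrite -cbi// bv linear0 scale0r.
have FT : F ord_max = fullv by case: cF.
have bF i : (b @: F i)%VS = F i.
  apply/eqP; rewrite eqEdim limg_dim_eq ?b0 ?capv0// leqnn andbT.
  move: i; apply/(filt_adapted _ (filtration_mono cF) ad) => i.
  have [J|J] := boolP (jump F fullv i); first by rewrite be// (adapted_mem ad').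
  by rewrite (adapted_zero ad)// linear0 mem0v.
exists b; first by split.
have JST (i : 'I_l.+1) : jump F S i = jump F T i by rewrite /jump !dST.
apply/eqP; rewrite eqEdim limg_dim_eq ?b0 ?capv0//.
rewrite -[in X in _ && X](capfv S) -[in X in _ && X](capfv T) -FT dST leqnn andbT.
apply/(sub_adapted _ _ ad) => i J.
rewrite be ?(adapted_sub ad') -?JST//.
by apply: (jump_full cF _ J).
Qed.

End AdaptedConsequences.

Section Mapsto.
Variables (K : fieldType) (A : finType) (V W : A -> vectType K).
Variables (T : forall a, {vspace V a}) (I : forall a, {vspace W a}).

Lemma mapsto_exists : exists X : {vspace dirsum (fun a => 'Hom(V a, W a))},
  forall Phi, Phi \in X <-> forall a, (Phi a @: T a <= I a)%VS.
Proof.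
apply: vspace_exists => [a|k u v uP vP a].
  by rewrite ffunE lim0g sub0v.
apply/subvP => _ /memv_imgP[x xT ->].
rewrite dirsumDE dirsumZE add_lfunE scale_lfunE rpredD ?rpredZ//.
  exact: (subvP (uP a)) _ (memv_img _ xT).
exact: (subvP (vP a)) _ (memv_img _ xT).
Qed.

Definition mapsto := projT1 (cid mapsto_exists).

Lemma mapstoP Phi : Phi \in mapsto <-> forall a, (Phi a @: T a <= I a)%VS.
Proof. exact: (projT2 (cid mapsto_exists)). Qed.

Lemma codim_mapsto (l : A -> nat) (F : forall a, 'I_(l a).+1 -> {vspace V a}) :
  (forall a, complete_filtration (@F a)) ->
  \dim {: dirsum (fun a => 'Hom(V a, W a))}
  = (\dim mapsto + \sum_a \dim (T a) * (\dim {: W a} - \dim (I a)))%N.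
Proof.
move=> cF.
have ad a := cid (adapted_exists (cF a) (T a)).
have ad' a := cid (projT2 (ad a)).
have adP a := projT2 (ad' a).
rewrite (dim_adapted_hom (U := fun a _ => fullv) adP); last first.
  by move=> Phi; split=> *; exact: memvf.
rewrite (dim_adapted_hom (U := fun a i => if jump (@F a) (T a) i then I a else fullv) adP).
  rewrite -big_split; apply: eq_bigr => a _ /=.
  rewrite (dim_sum_jumpT (cF a) (T a)) big_distrl -big_split /=.
  apply: eq_bigr => i _; have [J|J] := boolP (jump _ (T a) i).
    by rewrite (jump_full (cF a) _ J)// !mul1n subnKC// dimvS ?subvf.
  by rewrite mul0n addn0.
move=> Phi; rewrite mapstoP; split=> PhiP a.
  move=> i; case: ifP => J; last exact: memvf.
  exact: (sub_adapted _ _ (adP a)).1.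
apply: (sub_adapted _ _ (adP a)).2 => i J.
by have := PhiP a i; rewrite J.
Qed.

End Mapsto.

(** * Bounds on Ext by restriction to a pair of subfamilies *)

Section ExtBounds.
Variables (K : fieldType) (Q : quiver) (V W : vertex Q -> vectType K).
Variables (l : vertex Q -> nat) (F : subspace_chain V l) (G : subspace_chain W l).
Hypothesis F_filtration : forall x, complete_filtration (@F x).
Hypothesis G_mono : forall x, {homo @G x : i j / (i <= j)%N >-> (i <= j)%VS}.

Lemma deltaE (v : rep_sum V V) (w : rep_sum W W) (Phi : hom_sum V W) a :
  delta v w Phi a = (Phi (tgt a) \o v a)%VF - (w a \o Phi (src a))%VF.
Proof. by rewrite lfunE /= ffunE. Qed.

Lemma delta0P (v : rep_sum V V) (w : rep_sum W W) (Phi : hom_sum V W) :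
  delta v w Phi = 0 <-> forall a, (Phi (tgt a) \o v a)%VF = (w a \o Phi (src a))%VF.
Proof.
split=> [D0 a|D0]; first by apply/subr0_eq; rewrite -deltaE D0 ffunE.
by apply/ffunP => a; rewrite deltaE D0 subrr ffunE.
Qed.

Lemma dim_Ext (v : rep_sum V V) (w : rep_sum W W) :
  (\dim (Ext F G v w) + \dim (delta v w @: filtered_hom F G)
   = \dim {: rep_sum V W})%N.
Proof. by rewrite dimv_compl subnK// dimvS ?subvf. Qed.

Variables (T : subfamily V) (I : subfamily W).

Definition rep_mapsto : {vspace rep_sum V W} :=
  mapsto (fun a : arrow Q => T (src a)) (fun a => I (tgt a)).

Definition hom_mapsto : {vspace hom_sum V W} := mapsto T I.

(** The dimension of the space of arrow families from [T] to the quotient [W/I]. *)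
Definition rep_codim :=
  (\sum_(a : arrow Q) \dim (T (src a)) * (\dim {: W (tgt a)} - \dim (I (tgt a))))%N.

(** The dimension of the space of filtered maps from [T] to [W/I], both with their induced
    filtrations. Thus [hom_codim] minus [rep_codim] is the filtered Euler number of this pair. *)
Definition hom_codim :=
  (\sum_x \sum_(i < (l x).+1)
     jump (@F x) (T x) i * (\dim (@G x i) - \dim (@G x i :&: I x)))%N.

Lemma hom_mapstoP Phi : Phi \in hom_mapsto <-> forall x, (Phi x @: T x <= I x)%VS.
Proof. exact: mapstoP. Qed.

Lemma rep_mapstoP psi :
  psi \in rep_mapsto <-> forall a, (psi a @: T (src a) <= I (tgt a))%VS.
Proof. exact: mapstoP. Qed.

Lemma dim_rep_mapsto : \dim {: rep_sum V W} = (\dim rep_mapsto + rep_codim)%N.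
Proof. exact: (codim_mapsto _ _ (fun a => F_filtration (src a))). Qed.

Lemma dim_filtered_mapsto :
  \dim (filtered_hom F G)
  = (\dim (filtered_hom F G :&: hom_mapsto) + hom_codim)%N.
Proof.
have ad x := cid (adapted_exists (F_filtration x) (T x)).
have ad' x := cid (projT2 (ad x)).
have adP x := projT2 (ad' x).
rewrite dim_filtered_hom//.
pose U x (i : 'I_(l x).+1) := (if jump (@F x) (T x) i then @G x i :&: I x else @G x i)%VS.
rewrite (@dim_adapted_hom _ _ V W l F T _ _ U
  (filtered_hom F G :&: hom_mapsto)%VS adP).
  rewrite -big_split; apply: eq_bigr => x _ /=.
  rewrite -big_split /=; apply: eq_bigr => i _.
  rewrite /U; have [J|J] := boolP (jump _ (T x) i); last by rewrite mul0n addn0.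
  by rewrite (jump_full (F_filtration x) _ J)// !mul1n subnKC// dimvS ?capvSl.
move=> Phi; split=> [/memv_capP[]|PhiP].
  move=> /filtered_homP PhiFG /hom_mapstoP PhiTI x i.
  have Gi := (filt_adapted _ (@G_mono x) (adP x)).1 (PhiFG x) i.
  rewrite /U; case: ifP => J //; rewrite memv_cap Gi /=.
  exact: (sub_adapted _ _ (adP x)).1.
apply/memv_capP; split.
  apply/filtered_homP => x.
  apply: (filt_adapted _ (@G_mono x) (adP x)).2 => i.
  by have := PhiP x i; rewrite /U; case: ifP => // _ /memv_capP[].
apply/hom_mapstoP => x; apply: (sub_adapted _ _ (adP x)).2 => i J.
by have := PhiP x i; rewrite /U J => /memv_capP[].
Qed.

Lemma delta_mapsto v w : subrep v T -> subrep w I ->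
  (delta v w @: (filtered_hom F G :&: hom_mapsto) <= rep_mapsto)%VS.
Proof.
move=> vT wI; apply/subvP => _ /memv_imgP[Phi /memv_capP[_ /hom_mapstoP PhiTI] ->].
apply/rep_mapstoP => a; apply/subvP => _ /memv_imgP[u uT ->].
rewrite deltaE add_lfunE opp_lfunE !comp_lfunE rpredB//.
  apply: (subvP (PhiTI _)); apply: memv_img; apply: (subvP (vT a)).
  exact: memv_img.
apply: (subvP (wI a)); apply: memv_img; apply: (subvP (PhiTI _)).
exact: memv_img.
Qed.

(** The map [delta v w] sends [g'], the maps carrying [T] into [I], into [rep_mapsto], and a
    complement of [g'] in the filtered maps has dimension [hom_codim]. Equivalently, Ext surjects
    onto the Ext of the restricted and quotient representations. *)
Lemma Ext_lower_bound v w : subrep v T -> subrep w I ->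
  (rep_codim <= \dim (Ext F G v w) + hom_codim)%N.
Proof.
move=> vT wI; have := dim_Ext v w; rewrite dim_rep_mapsto.
have := dim_filtered_mapsto; set g := filtered_hom F G; set g' := (g :&: _)%VS.
move=> dg dE.
have le : (\dim (delta v w @: g) <= \dim rep_mapsto + hom_codim)%N.
  have dgd : (\dim (g :\: g') = hom_codim)%N.
    have := dimv_cap_compl g g'; rewrite (capv_idPr (capvSl _ _)) dg => /eqP.
    by rewrite eqn_add2l => /eqP.
  rewrite -dgd -[in X in (X <= _)%N](addv_diff_cap g g') (capv_idPr (capvSl _ _)).
  rewrite addvC limgD.
  apply: leq_trans (dimv_add_leqif _ _) _; apply: leq_add.
    exact/dimvS/delta_mapsto.
  by rewrite -(limg_ker_dim (delta v w) (g :\: g')) leq_addl.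
rewrite -(leq_add2l (\dim rep_mapsto)) -dE addnCA leq_add2l//.
Qed.

(** Since the kernel lies in [g'], the rank of [delta v w] on all filtered maps exceeds its rank on
    [g'] by exactly [hom_codim], and the latter is at least the dimension of [rep_mapsto]. *)
Lemma Ext_upper_bound v w :
  (rep_mapsto <= delta v w @: (filtered_hom F G :&: hom_mapsto))%VS ->
  (filtered_hom F G :&: lker (delta v w) <= hom_mapsto)%VS ->
  (\dim (Ext F G v w) + hom_codim <= rep_codim)%N.
Proof.
move=> /dimvS dle kle; have := dim_Ext v w; rewrite dim_rep_mapsto.
have := dim_filtered_mapsto; set g := filtered_hom F G in kle dle *.
set g' := (g :&: hom_mapsto)%VS in dle * => dg dE.
have := limg_ker_dim (delta v w) g; have := limg_ker_dim (delta v w) g'.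
have -> : (g' :&: lker (delta v w) = g :&: lker (delta v w))%VS.
  apply/eqP; rewrite eqEsubv capvS ?capvSl//= !subv_cap capvSl kle/= capvSr//.
move: dg dE dle; set a := \dim g; set b := \dim g'; set c := \dim (_ :&: lker _).
set p := \dim (delta v w @: g); set q := \dim (delta v w @: g').
by move=> *; lia.
Qed.

End ExtBounds.

(** * Homomorphisms of maximal rank *)

Lemma eq_of_leq_sum (I : finType) (f h : I -> nat) :
  (forall i, f i <= h i)%N -> (\sum_i h i <= \sum_i f i)%N -> forall i, f i = h i.
Proof.
move=> fh tot i; apply/eqP; rewrite eqn_leq fh leqNgt; apply/negP => lt.
move: tot; rewrite leqNgt => /negP; apply.
rewrite (bigD1 i)//= [X in (_ < X)%N](bigD1 i)//= -addSn leq_add//.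
by apply: leq_sum => j _.
Qed.

Section MaximalHom.
Variables (k : numFieldType) (Q : quiver) (V W : vertex Q -> vectType (k : fieldType)).
Variables (l : vertex Q -> nat) (F : subspace_chain V l) (G : subspace_chain W l).
Local Notation g := (filtered_hom F G).

Lemma ext_attained : exists (v : rep_sum V V) (w : rep_sum W W),
  \dim (Ext F G v w) = ext F G.
Proof.
rewrite /ext; case: ex_minnP => n /asboolP[v [w ->]] _; by exists v, w.
Qed.

Lemma ext_le (v : rep_sum V V) (w : rep_sum W W) : (ext F G <= \dim (Ext F G v w))%N.
Proof.
by rewrite /ext; case: ex_minnP => n _; apply; apply/asboolP; exists v, w.
Qed.

Lemma Ext_rank v w v' w' : (\dim (Ext F G v w) <= \dim (Ext F G v' w'))%N =
  (\dim (delta v' w' @: g) <= \dim (delta v w @: g))%N.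
Proof.
have arith a b a' b' n : (a + b = n -> a' + b' = n -> (a <= a') = (b' <= b))%N by lia.
exact: arith (dim_Ext F G v w) (dim_Ext F G v' w').
Qed.

Lemma polycurve_delta (v : k -> rep_sum V V) (w : k -> rep_sum W W) :
  polycurve v -> polycurve w -> polycurve (fun t => delta (v t) (w t)).
Proof.
move=> vp wp; apply: polycurve_lfun => Phi; apply: polycurve_rep => a.
apply: eq_polycurve (polycurveB (polycurve_comp (polycurve_cst (Phi (tgt a)))
  (polycurve_rep_coord a vp)) (polycurve_comp (polycurve_rep_coord a wp)
  (polycurve_cst (Phi (src a))))) => t.
by rewrite deltaE.
Qed.

Lemma Ext_semicontinuous (v : k -> rep_sum V V) (w : k -> rep_sum W W) t0 :
  polycurve v -> polycurve w ->
  generically (fun t => \dim (Ext F G (v t) (w t)) <= \dim (Ext F G (v t0) (w t0)))%N.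
Proof.
move=> vp wp; have := rank_semicontinuous g t0 (polycurve_delta vp wp).
by apply: generically_mono => t; rewrite -Ext_rank.
Qed.

Definition is_hom (v : rep_sum V V) (w : rep_sum W W) Phi :=
  Phi \in g /\ delta v w Phi = 0.

(** Minimal Ext is maximal rank of [delta], so the rank hypothesis of [kernel_deformation] holds for
    every [t]. *)
Lemma hom_deformation (v : k -> rep_sum V V) (w : k -> rep_sum W W) Phi :
  polycurve v -> polycurve w -> \dim (Ext F G (v 0) (w 0)) = ext F G ->
  is_hom (v 0) (w 0) Phi ->
  exists y, [/\ polycurve y, y 0 = Phi & forall t, is_hom (v t) (w t) (y t)].
Proof.
move=> vp wp vw0 [Phig dPhi].
have [|y [yp y0 yg dy]] := @kernel_deformation _ (hom_sum V W) (rep_sum V W)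
    (fun t => delta (v t) (w t)) g Phi (polycurve_delta vp wp) _ Phig dPhi.
  apply: generically_all => t /=.
  by rewrite -Ext_rank vw0; exact: ext_le.
exists y; split; [exact yp|exact y0|move=> t; split; [exact: yg|exact: dy]].
Qed.

(** It stands for the quotient map by [G x i], realised as an endomorphism with that kernel. *)
Definition coproj x i : 'End(W x) := (\1 - projv (@G x i))%VF.

Lemma lker_coproj x i : lker (coproj i) = @G x i.
Proof.
apply/vspaceP => u; rewrite memv_ker add_lfunE opp_lfunE id_lfunE subr_eq0.
apply/eqP/idP => [->|uG]; [exact: memv_proj|by rewrite projv_id].
Qed.

Definition rank_src (Phi : hom_sum V W) x i := \dim (Phi x @: @F x i).
Definition rank_tgt (Phi : hom_sum V W) x i := \dim (limg (coproj i \o Phi x)).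

(** Each summand is lower semicontinuous, so maximality of the sum freezes them all generically.
    They fix the position of the kernel relative to [F] and of the image relative to [G]. *)
Definition total_rank (Phi : hom_sum V W) :=
  (\sum_x \sum_(i < (l x).+1) (rank_src Phi i + rank_tgt Phi i))%N.

Definition same_ranks (Phi Psi : hom_sum V W) :=
  forall x (i : 'I_(l x).+1),
    rank_src Phi i = rank_src Psi i /\ rank_tgt Phi i = rank_tgt Psi i.

Lemma same_ranks_total Phi Psi : same_ranks Phi Psi -> total_rank Phi = total_rank Psi.
Proof.
by move=> PP; apply: eq_bigr => x _; apply: eq_bigr => i _; case: (PP x i) => -> ->.
Qed.

Lemma same_ranks_generic (y : k -> hom_sum V W) t0 : polycurve y ->
  generically (fun t => total_rank (y t) <= total_rank (y t0))%N ->
  generically (fun t => same_ranks (y t) (y t0)).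
Proof.
move=> yp ymax.
have gen : generically (fun t => forall x (i : 'I_(l x).+1),
   rank_src (y t0) i <= rank_src (y t) i /\ rank_tgt (y t0) i <= rank_tgt (y t) i)%N.
  do 2![apply: generically_forall => ?]; apply: generically_and.
    exact/rank_semicontinuous/polycurve_hom_coord.
  by apply/rank_semicontinuous/polycurve_comp/polycurve_hom_coord => //; exact: polycurve_cst.
apply: generically_mono (generically_and gen ymax) => t [le tot] x i.
have le' z j : (rank_src (y t0) j + rank_tgt (y t0) j
    <= rank_src (y t) j + rank_tgt (y t) (x := z) j)%N.
  by have [] := le z j; exact: leq_add.
have ex : (\sum_(j < (l x).+1) (rank_src (y t0) j + rank_tgt (y t0) j)
    = \sum_(j < (l x).+1) (rank_src (y t) j + rank_tgt (y t) j))%N.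
  move: x {i}; apply: eq_of_leq_sum tot => z; exact: leq_sum.
have ei : (rank_src (y t0) i + rank_tgt (y t0) i
    = rank_src (y t) i + rank_tgt (y t) i)%N.
  move: i; apply: eq_of_leq_sum => [i|]; [exact: le'|by rewrite ex].
by have [] := le x i; move: ei; lia.
Qed.

Definition max_hom v w Phi :=
  [/\ \dim (Ext F G v w) = ext F G, is_hom v w Phi & forall v' w' Psi,
      \dim (Ext F G v' w') = ext F G -> is_hom v' w' Psi ->
      (total_rank Psi <= total_rank Phi)%N].

Lemma max_hom_exists : exists v w Phi, max_hom v w Phi.
Proof.
pose P n := `[< exists v w Phi, [/\ \dim (Ext F G v w) = ext F G, is_hom v w Phi
                                 & total_rank Phi = n] >].
have exP : exists n, P n.
  have [v [w vw]] := ext_attained.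
  exists (total_rank 0); apply/asboolP; exists v, w, 0; split=> //.
  by split; [exact: mem0v|exact: linear0].
have ubP n : P n -> (n <= \sum_x \sum_(i < (l x).+1) (\dim {: W x} + \dim {: W x}))%N.
  move=> /asboolP[v [w [Phi [_ _ <-]]]].
  by do 2![apply: leq_sum => ? _]; apply: leq_add; exact/dimvS/subvf.
have [n /asboolP[v [w [Phi [vw hPhi tot]]]] nmax] := ex_maxnP exP ubP.
exists v, w, Phi; split=> // v' w' Psi vw' hPsi; rewrite tot; apply: nmax.
by apply/asboolP; exists v', w', Psi.
Qed.

Lemma max_hom_tangent (y z : k -> hom_sum V W) :
  (forall x, complete_filtration (@F x)) ->
  polycurve z -> (forall t, y t = y 0 + t *: z t) ->
  generically (fun t => total_rank (y t) <= total_rank (y 0%R))%N ->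
  forall x, (z 0%R x @: lker (y 0%R x) <= limg (y 0%R x))%VS.
Proof.
move=> cF zp yz ymax x; apply/subvP => _ /memv_imgP[u + ->]; rewrite memv_ker => /eqP yu.
have yp : polycurve y.
  by apply: eq_polycurve (polycurveD (polycurve_cst (y 0)) (polycurveZX zp)) => t.
have := @kernel_deriv_image _ _ _ (fun t => y t x) (fun t => z t x) fullv u.
apply => //; last exact: memvf.
- exact: polycurve_hom_coord.
- by move=> t; rewrite yz dirsumDE dirsumZE.
apply: generically_mono (same_ranks_generic yp ymax) => t /(_ x ord_max)[].
by rewrite /rank_src; have [_ -> _] := cF x; move=> -> _.
Qed.

Lemma dim_ker_rank (Phi : hom_sum V W) x i :
  (\dim (@F x i :&: lker (Phi x)) + rank_src Phi i = \dim (@F x i))%N.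
Proof. exact: limg_ker_dim. Qed.

Lemma dim_img_rank (Phi : hom_sum V W) x i :
  (\dim (@G x i :&: limg (Phi x)) + rank_tgt Phi i = \dim (limg (Phi x)))%N.
Proof. by rewrite /rank_tgt limg_comp capvC -lker_coproj limg_ker_dim. Qed.

Lemma is_hom_ker v w Phi : is_hom v w Phi -> subrep v (fun x => lker (Phi x)).
Proof.
move=> [_ /delta0P D0] a; apply/subvP => _ /memv_imgP[u + ->].
rewrite !memv_ker -comp_lfunE D0 comp_lfunE => /eqP ->; by rewrite linear0.
Qed.

Lemma is_hom_img v w Phi : is_hom v w Phi -> subrep w (fun x => limg (Phi x)).
Proof.
move=> [_ /delta0P D0] a; apply/subvP => _ /memv_imgP[u + ->].
by move=> /memv_imgP[u' _ ->]; rewrite -comp_lfunE -D0 comp_lfunE memv_img// memvf.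
Qed.

(** Split [psi] by the projection onto [lker f]: the part on the kernel lands in the image of [h]
    and lifts through [h], while the rest kills the kernel and factors through [f]. *)
Lemma factor_ker_img (E1 E2 E1' E2' : vectType (k : fieldType)) (f : 'Hom(E1, E1'))
    (h : 'Hom(E2, E2')) (psi : 'Hom(E1, E2')) :
  (psi @: lker f <= limg h)%VS ->
  exists (a : 'Hom(E1, E2)) (b : 'Hom(E1', E2')), psi = (h \o a)%VF - (b \o f)%VF.
Proof.
move=> psiK; pose p := projv (lker f).
exists (h^-1 \o psi \o p)%VF, (- (psi \o (\1 - p) \o f^-1))%VF.
apply/lfunP => u; rewrite add_lfunE opp_lfunE !comp_lfunE opp_lfunE opprK !comp_lfunE.
rewrite limg_lfunVK; last by apply: (subvP psiK); apply/memv_img/memv_proj.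
have kerd : f^-1%VF (f u) - u \in lker f.
  by rewrite memv_ker linearB /= limg_lfunVK ?subrr// memv_img// memvf.
have -> : (\1 - p)%VF (f^-1%VF (f u)) = u - p u.
  have := projv_id kerd; rewrite -/p linearB /= => pE.
  rewrite add_lfunE opp_lfunE id_lfunE.
  have -> : p (f^-1%VF (f u)) = f^-1%VF (f u) - u + p u by rewrite -pE subrK.
  by rewrite opprD opprB addrA [X in X - _]addrC subrK.
by rewrite linearB addrC subrK.
Qed.

(** Maximality of [Phi] supplies both hypotheses of [Ext_upper_bound] for its own kernel and
    image. *)
Lemma max_hom_ext v w Phi :
  (forall x, complete_filtration (@F x)) ->
  (forall x, {homo @G x : i j / (i <= j)%N >-> (i <= j)%VS}) ->
  max_hom v w Phi ->
  (ext F G + hom_codim F G (fun x => lker (Phi x)) (fun x => limg (Phi x))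
   <= rep_codim (fun x => lker (Phi x)) (fun x => limg (Phi x)))%N.
Proof.
move=> cF Gmono [vw hPhi Pmax]; rewrite -vw.
(* Along a curve through [(v, w)] Ext stays minimal generically, so no homomorphism on the curve can
   have larger total rank than [Phi]. *)
have tang (v' : k -> rep_sum V V) (w' : k -> rep_sum W W) (y z : k -> hom_sum V W) :
    polycurve v' -> polycurve w' -> v' 0 = v -> w' 0 = w ->
    polycurve z -> (forall t, y t = y 0 + t *: z t) -> y 0 = Phi ->
    (forall t, is_hom (v' t) (w' t) (y t)) ->
  forall x, (z 0%R x @: lker (Phi x) <= limg (Phi x))%VS.
  move=> vp wp v0 w0 zp yz y0 yh x; rewrite -y0; apply: max_hom_tangent => //.
  have : generically (fun t => \dim (Ext F G (v' t) (w' t)) <= \dim (Ext F G (v' 0%R) (w' 0%R)))%N.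
    exact: Ext_semicontinuous.
  apply: generically_mono => t; rewrite v0 w0 vw => le; rewrite y0.
  by apply: Pmax (yh t); apply/eqP; rewrite eqn_leq le ext_le.
apply: Ext_upper_bound => //.
  (* Such a [psi] equals [delta v' w' Phi] for some direction [(v', w')]. Deforming [Phi] along this
     line gives a tangent [z 0] with [delta v w (z 0) = - psi], and [tang] places it in
     [hom_mapsto]. *)
  apply/subvP => psi /rep_mapstoP psiKI.
  pose v' : rep_sum V V := [ffun a => projT1 (cid (factor_ker_img (psiKI a)))
                                      : 'Hom(V (src a), V (tgt a))].
  pose w' : rep_sum W W := [ffun a => projT1 (cid (projT2 (cid (factor_ker_img (psiKI a)))))
                                      : 'Hom(W (src a), W (tgt a))].
  have psiE a : psi a = (Phi (tgt a) \o v' a)%VF - (w' a \o Phi (src a))%VF.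
    by rewrite !ffunE; exact: projT2 (cid (projT2 (cid (factor_ker_img (psiKI a))))).
  have vp := polycurve_rep_line v v'.
  have wp := polycurve_rep_line w w'.
  have v0 : v + 0 *: v' = v by rewrite scale0r addr0.
  have w0 : w + 0 *: w' = w by rewrite scale0r addr0.
  have [||y [yp y0 yh]] := @hom_deformation _ _ Phi vp wp; rewrite ?v0 ?w0//.
  have [z zp yz] := polycurve_deriv yp.
  have z0g : z 0 \in g.
    apply: (polycurve_mem zp); apply: generically_mono (generically_neq 0) => t tn0.
    suff -> : z t = t^-1 *: (y t - y 0).
      by rewrite rpredZ// rpredB//; [case: (yh t)|case: (yh 0)].
    by rewrite yz addrC addKr scalerA mulVf// scale1r.
  have deltaD t : delta (v + t *: v') (w + t *: w')
      = delta v w + t *: delta v' w'.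
    apply/lfunP => Psi; apply/ffunP => a; apply/lfunP => u.
    rewrite add_lfunE scale_lfunE dirsumDE dirsumZE !deltaE.
    rewrite !(add_lfunE, opp_lfunE, scale_lfunE, comp_lfunE, dirsumDE, dirsumZE).
    by rewrite linearD linearZ /= scalerBr opprD addrACA.
  have := @kernel_first_order _ _ _ (fun t => delta (v + t *: v') (w + t *: w'))
    (fun=> delta v' w') y z (polycurve_cst _) zp.
  rewrite v0 w0 y0 => /(_ deltaD).
  have yz' t : y t = Phi + t *: z t by rewrite -y0.
  move=> /(_ yz' (fun t => (yh t).2)) /eqP; rewrite addrC addr_eq0 => /eqP d'.
  have -> : psi = - delta v w (z 0).
    by rewrite -d'; apply/ffunP => a; rewrite (deltaE v' w' Phi a); exact: psiE.
  rewrite rpredN memv_img// memv_cap z0g /=; apply/hom_mapstoP.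
  exact: tang vp wp v0 w0 zp yz y0 yh.
(* For [Psi] in the kernel the pair stays fixed, and [Phi + t *: Psi] is a line of homomorphisms
   with tangent [Psi]. *)
apply/subvP => Psi /memv_capP[Psig]; rewrite memv_ker => /eqP dPsi.
apply/hom_mapstoP; apply: (tang _ _ (fun t => Phi + t *: Psi) (fun=> Psi)
  (polycurve_rep_cst v) (polycurve_rep_cst w)) => //.
- exact: polycurve_hom_cst.
- by move=> t; rewrite scale0r addr0.
- by rewrite scale0r addr0.
move=> t; case: hPhi => Phig dPhi; split; first by rewrite rpredD// rpredZ.
by rewrite linearD linearZ /= dPhi dPsi scaler0 addr0.
Qed.

End MaximalHom.

(** * Passing to the kernel of a maximal homomorphism *)

Section KernelStep.
Variables (k : numFieldType) (Q : quiver) (V W : vertex Q -> vectType (k : fieldType)).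
Variables (l : vertex Q -> nat) (F : subspace_chain V l) (G : subspace_chain W l).
Hypothesis F_filtration : forall x, complete_filtration (@F x).
Hypothesis G_mono : forall x, {homo @G x : i j / (i <= j)%N >-> (i <= j)%VS}.
Variables (v0 : rep_sum V V) (w0 : rep_sum W W) (Phi0 : hom_sum V W).
Hypothesis Phi0_max : max_hom F G v0 w0 Phi0.

Let K : subfamily V := fun x => lker (Phi0 x).
Let KV := subfamily_space K.
Let FK : subspace_chain KV l := induced_chain F K.

Lemma FK_filtration x : complete_filtration (@FK x).
Proof. exact: induced_filtration. Qed.

Lemma hom_curve_same_ranks (v : k -> rep_sum V V) (w : k -> rep_sum W W) y :
  polycurve v -> polycurve w -> polycurve y ->
  (forall t, is_hom F G (v t) (w t) (y t)) ->
  \dim (Ext F G (v 0) (w 0)) = ext F G -> same_ranks F G (y 0) Phi0 ->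
  generically (fun t => same_ranks F G (y t) Phi0).
Proof.
move=> vp wp yp yh vw0 y0; have [_ _ Pmax] := Phi0_max.
have /(same_ranks_generic yp) :
    generically (fun t => total_rank F G (y t) <= total_rank F G (y 0%R))%N.
  apply: generically_mono (Ext_semicontinuous F G 0 vp wp) => t.
  rewrite vw0 => le; rewrite (same_ranks_total y0); apply: Pmax (yh t).
  by apply/eqP; rewrite eqn_leq le ext_le.
apply: generically_mono => t yt x i; case: (yt x i) => -> ->; exact: y0.
Qed.

Lemma same_ranks_ker Phi x i : same_ranks F G Phi Phi0 ->
  \dim (@F x i :&: lker (Phi x)) = \dim (@F x i :&: K x).
Proof.
move=> /(_ x i)[e _]; have := dim_ker_rank F Phi i; have := dim_ker_rank F Phi0 i.
by rewrite e => <- /addIn.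
Qed.

Lemma same_ranks_img Phi x i : same_ranks F G Phi Phi0 ->
  \dim (limg (Phi x)) = \dim (limg (Phi0 x)) /\
  \dim (@G x i :&: limg (Phi x)) = \dim (@G x i :&: limg (Phi0 x)).
Proof.
move=> sr; have [_ FT _] := F_filtration x.
have e : \dim (limg (Phi x)) = \dim (limg (Phi0 x)).
  by have [] := sr x ord_max; rewrite /rank_src FT.
split=> //; have [_ e'] := sr x i.
have := dim_img_rank G Phi i; have := dim_img_rank G Phi0 i.
by rewrite -e' -e => <- /addIn.
Qed.

(** Take [(u, wh)] optimal for the kernel and move [w0] to [wh] along a line, deforming [Phi0] with
    it. At a generic parameter Ext of [(u, w t)] is no larger than at [wh], and [w t] stabilises an
    image in the same position as that of [Phi0]. The lower bound for this image meets the upper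
    bound of [max_hom_ext]. *)
Lemma ext_kernel : (ext F G <= ext FK G)%N.
Proof.
have [vw hPhi _] := Phi0_max; have := max_hom_ext F_filtration G_mono Phi0_max.
have [u [wh uwh]] := ext_attained FK G.
pose w t := w0 + t *: (wh - w0).
have wp : polycurve w := polycurve_rep_line _ _.
have vp := polycurve_rep_cst v0.
have up := polycurve_rep_cst u.
have w00 : w 0 = w0 by rewrite /w scale0r addr0.
have w1 : w 1 = wh by rewrite /w scale1r addrC subrK.
have [||y [yp y0 yh]] := @hom_deformation _ _ _ _ _ F G _ _ Phi0 vp wp.
- by rewrite w00.
- by rewrite w00.
have sr : generically (fun t => same_ranks F G (y t) Phi0).
  apply: (hom_curve_same_ranks vp wp yp yh); first by rewrite w00.
  by rewrite y0.
have [t [yt Et]] := generically_ex (generically_and sr (Ext_semicontinuous FK G 1 up wp)).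
have ufull : subrep u (fun x => fullv) by move=> a; exact: subvf.
have := Ext_lower_bound FK_filtration G_mono ufull (is_hom_img (yh t)).
have -> : rep_codim (fun x => fullv : {vspace KV x}) (fun x => limg (y t x))
    = rep_codim K (fun x => limg (Phi0 x)).
  apply: eq_bigr => a _; have [-> _] := @same_ranks_img (y t) (tgt a) ord0 yt.
  by rewrite dimvf.
have -> : hom_codim FK G (fun x => fullv) (fun x => limg (y t x))
    = hom_codim F G K (fun x => limg (Phi0 x)).
  apply: eq_bigr => x _; apply: eq_bigr => i _; rewrite jump_induced.
  by have [_ ->] := @same_ranks_img (y t) x i yt.
move=> low upp; move: Et; rewrite w1 uwh; apply: leq_trans.
by rewrite -(leq_add2r (hom_codim F G K (fun x => limg (Phi0 x)))) (leq_trans upp).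
Qed.

End KernelStep.

(** * Generic subrepresentations *)

Definition embedding (k : fieldType) (Q : quiver) (D V : vertex Q -> vectType k)
    (l : vertex Q -> nat) (FD : subspace_chain D l) (F : subspace_chain V l)
    (j : hom_sum D V) : Prop :=
  (forall x, lker (j x) = 0%VS) /\
  (forall x i, (j x @: FD x i = F x i :&: limg (j x))%VS).

Definition image_family (k : fieldType) (Q : quiver) (D V : vertex Q -> vectType k)
    (j : hom_sum D V) : subfamily V := fun x => limg (j x).

(* The generic representation on [V] has a subrepresentation that is isomorphic
   to [D] as a filtered space and varies algebraically; [O] plays the role of a
   dense open subset, being tested along polynomial curves only. *)
Definition generic_sub (k : numFieldType) (Q : quiver) (D V : vertex Q -> vectType (k : fieldType))
    (l : vertex Q -> nat) (FD : subspace_chain D l) (F : subspace_chain V l) : Prop :=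
  exists O : rep_sum V V -> Prop, (exists v, O v) /\
    forall v : k -> rep_sum V V, polycurve v -> O (v 0) ->
      generically (fun t => O (v t)) /\
      exists2 j : k -> hom_sum D V, polycurve j &
        generically (fun t => embedding FD F (j t) /\ subrep (v t) (image_family (j t))).

Lemma generic_sub_refl (k : numFieldType) (Q : quiver) (V : vertex Q -> vectType (k : fieldType))
    (l : vertex Q -> nat) (F : subspace_chain V l) : generic_sub F F.
Proof.
exists (fun=> True); split; first by exists 0.
move=> v vp _; split; first exact: generically_all.
exists (fun=> [ffun x => \1%VF : 'End(V x)]); first exact: polycurve_hom_cst.
apply: generically_all => t; split; first split.
- by move=> x; apply/eqP/lker0P => u u'; rewrite ffunE !id_lfunE.
- by move=> x i; rewrite ffunE !lim1g capvf.
- by move=> a; rewrite /image_family !ffunE !lim1g subvf.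
Qed.

Lemma embedding_comp (k : fieldType) (Q : quiver) (D E V : vertex Q -> vectType k)
    (l : vertex Q -> nat) (FD : subspace_chain D l) (FE : subspace_chain E l)
    (F : subspace_chain V l) (h : hom_sum E V) (j : hom_sum D E) :
  embedding FE F h -> embedding FD FE j ->
  embedding FD F ([ffun x => (h x \o j x)%VF : 'Hom(D x, V x)] : hom_sum D V).
Proof.
move=> [h0 hF] [j0 jF]; split=> [x|x i].
  have /lker0P hI : lker (h x) == 0%VS by rewrite h0.
  have /lker0P jI : lker (j x) == 0%VS by rewrite j0.
  by rewrite ffunE; apply/eqP/lker0P => u u'; rewrite !comp_lfunE => /hI/jI.
rewrite ffunE !limg_comp jF lker0_img_cap ?h0// hF.
rewrite -capvA; congr (_ :&: _)%VS; apply/capv_idPr; exact: limgS (subvf _).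
Qed.

(** * Algebraic families of embeddings of the kernel *)

Section Postcomposition.
Variables (k : numFieldType) (Q : quiver) (V W : vertex Q -> vectType (k : fieldType)).
Variables (l : vertex Q -> nat) (F : subspace_chain V l) (G : subspace_chain W l).
Hypothesis F_filtration : forall x, complete_filtration (@F x).
Variable Phi0 : hom_sum V W.

Local Notation K := (fun x => lker (Phi0 x)).
Local Notation KV := (subfamily_space K).
Local Notation FK := (induced_chain F K).

Lemma postcomp_exists (Phi : hom_sum V W) :
  exists A : 'Hom(hom_sum KV V, hom_sum KV W),
    forall b x, A b x = (Phi x \o b x)%VF.
Proof.
pose f (b : hom_sum KV V) : hom_sum KV W :=
  [ffun x => (Phi x \o b x)%VF : 'Hom(KV x, W x)].
have fE b x : f b x = (Phi x \o b x)%VF by exact: ffunE.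
have [|A AE] := @lfun_exists _ (hom_sum KV V) (hom_sum KV W) f.
  move=> c b b'; apply/ffunP => x; rewrite dirsumDE dirsumZE !fE.
  by rewrite dirsumDE dirsumZE comp_lfunDr comp_lfunZr.
by exists A => b x; rewrite AE fE.
Qed.

Definition postcomp Phi := projT1 (cid (postcomp_exists Phi)).

Lemma postcompE Phi b x : postcomp Phi b x = (Phi x \o b x)%VF.
Proof. exact: (projT2 (cid (postcomp_exists Phi))). Qed.

(** The space in question consists of the filtered maps into the kernel of [Phi] with its induced
    filtration, and its dimension depends only on intersection dimensions fixed by the ranks. Hence
    [kernel_deformation] can move embeddings along with [Phi]. *)
Lemma dim_ker_postcomp Phi Psi : same_ranks F G Phi Phi0 -> same_ranks F G Psi Phi0 ->
  \dim (filtered_hom FK F :&: lker (postcomp Phi))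
  = \dim (filtered_hom FK F :&: lker (postcomp Psi)).
Proof.
suff H Phi' : same_ranks F G Phi' Phi0 ->
    \dim (filtered_hom FK F :&: lker (postcomp Phi')) = (\sum_x \sum_(i < (l x).+1)
      jump (@induced_chain _ _ _ _ F K x) fullv i * \dim (@F x i :&: K x))%N.
  by move=> /H -> /H ->.
move=> sr; pose FP : subspace_chain V l := fun x i => (@F x i :&: lker (Phi' x))%VS.
have -> : (filtered_hom FK F :&: lker (postcomp Phi'))%VS = filtered_hom FK FP.
  apply/vspaceP => b; apply/memv_capP/idP => [[/filtered_homP bF]|/filtered_homP bF].
    rewrite memv_ker => /eqP b0; apply/filtered_homP => x i; rewrite subv_cap bF /=.
    apply/subvP => _ /memv_imgP[u _ ->].
    by rewrite memv_ker -comp_lfunE -postcompE b0 ffunE lfunE.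
  split.
    by apply/filtered_homP => x i; apply: subv_trans (bF x i) _; exact: capvSl.
  rewrite memv_ker; apply/eqP/ffunP => x; rewrite postcompE ffunE.
  apply/lfunP => u; rewrite comp_lfunE lfunE; apply/eqP; rewrite -memv_ker.
  have := subvP (bF x ord_max) (b x u); rewrite memv_cap => /(_ _)/andP[]//.
  have [_ FT _] := induced_filtration K (F_filtration x).
  by apply: memv_img; rewrite FT memvf.
rewrite dim_filtered_hom => [|x|x i j ij].
- apply: eq_bigr => x _; apply: eq_bigr => i _; congr (_ * _)%N.
  exact: (same_ranks_ker i sr).
- exact: induced_filtration.
- by apply: capvS => //; exact: filtration_mono.
Qed.

Lemma postcomp_polycurve (y : k -> hom_sum V W) :
  polycurve y -> polycurve (fun t => postcomp (y t)).
Proof.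
move=> yp; apply: polycurve_lfun => b; apply: polycurve_hom => x.
apply: eq_polycurve (polycurve_comp (polycurve_hom_coord x yp) (polycurve_cst (b x))) => t.
by rewrite postcompE.
Qed.

Lemma embedding_kernel Phi (b : hom_sum KV V) : same_ranks F G Phi Phi0 ->
  b \in filtered_hom FK F -> (forall x, (Phi x \o b x)%VF = 0) -> (forall x, lker (b x) = 0%VS) ->
  embedding FK F b /\ forall x, limg (b x) = lker (Phi x).
Proof.
move=> sr /filtered_homP bF b0 binj.
have bdim x U : \dim (b x @: U) = \dim U by rewrite limg_dim_eq// binj capv0.
have bker x : limg (b x) = lker (Phi x).
  apply/eqP; rewrite eqEdim; apply/andP; split.
    apply/subvP => _ /memv_imgP[u _ ->].
    by rewrite memv_ker -comp_lfunE b0 lfunE.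
  rewrite bdim dimvf; have [_ FT _] := F_filtration x.
  by have := same_ranks_ker (x := x) ord_max sr; rewrite FT !capfv => ->.
split=> //; split=> // x i; apply/eqP; rewrite eqEdim subv_cap bF limgS ?subvf//=.
by rewrite bdim bker dim_induced_chain (same_ranks_ker i sr).
Qed.

End Postcomposition.

Section Intertwiner.
Variables (k : numFieldType) (Q : quiver) (E V : vertex Q -> vectType (k : fieldType)).
Let P : vectType (k : fieldType) := (rep_sum E E * k^o)%type.
Let R : vectType (k : fieldType) := rep_sum E V.

(** The representation induced on [E] by an embedding [b] depends rationally on [b]. Adjoining a
    scalar unknown [p.2] turns it into a solution of a homogeneous linear system, which can be
    followed polynomially. *)
Lemma intertwining_exists (v : rep_sum V V) (b : hom_sum E V) :
  exists A : 'Hom(P, R), forall (p : P) a,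
    A p a = p.2 *: (v a \o b (src a))%VF - (b (tgt a) \o p.1 a)%VF.
Proof.
pose f (p : P) : R := [ffun a => p.2 *: (v a \o b (src a))%VF
  - (b (tgt a) \o p.1 a)%VF : 'Hom(E (src a), V (tgt a))].
have fE p a : f p a = p.2 *: (v a \o b (src a))%VF - (b (tgt a) \o p.1 a)%VF.
  exact: ffunE.
have [|A AE] := @lfun_exists _ P R f.
  move=> c p q; apply/ffunP => a; rewrite dirsumDE dirsumZE !fE /=.
  rewrite dirsumDE dirsumZE comp_lfunDr -comp_lfunZr.
  by rewrite scalerDl scalerBr opprD addrACA scalerA.
by exists A => p a; rewrite (AE p); exact (fE p a).
Qed.

(** At 0 the injectivity of [b] confines the solutions to one line, and at a generic parameter the
    induced representation with scalar 1 is a nonzero solution. The rank therefore does not grow and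
    the solution deforms. *)
Lemma intertwiner_curve (v : k -> rep_sum V V) (b : k -> hom_sum E V) (c0 : k)
    (u0 : rep_sum E E) :
  polycurve v -> polycurve b -> (forall x, lker (b 0%R x) = 0%VS) -> c0 != 0 ->
  (forall a, c0 *: (v 0 a \o b 0 (src a))%VF = (b 0 (tgt a) \o u0 a)%VF) ->
  generically (fun t => (forall x, lker (b t x) = 0%VS)
                        /\ subrep (v t) (image_family (b t))) ->
  exists (c : k -> k) (u : k -> rep_sum E E),
    [/\ polyfun c, c 0 = c0, polycurve u, u 0 = u0 & forall t a,
      c t *: (v t a \o b t (src a))%VF = (b t (tgt a) \o u t a)%VF].
Proof.
move=> vp bp b0 c0n0 vbu gen.
pose A t := projT1 (cid (intertwining_exists (v t) (b t))).
have AE t p a : A t p a = p.2 *: (v t a \o b t (src a))%VF - (b t (tgt a) \o p.1 a)%VF.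
  exact: (projT2 (cid (intertwining_exists (v t) (b t)))).
have Ap : polycurve A.
  apply: polycurve_lfun => p; apply: polycurve_rep => a.
  apply: eq_polycurve (polycurveB (polycurveZ (polyfun_cst p.2) (polycurve_comp
    (polycurve_rep_coord a vp) (polycurve_hom_coord (src a) bp))) (polycurve_comp
    (polycurve_hom_coord (tgt a) bp) (polycurve_cst (p.1 a)))) => t.
  by symmetry; exact (AE t p a).
have ker0 : (lker (A 0%R) <= <[(u0, c0 : k^o) : P]>)%VS.
  apply/subvP => -[u c]; rewrite memv_ker => /eqP Auc; apply/vlineP.
  have uc a : c0 *: u a = c *: u0 a.
    have /lker0P bI : lker (b 0%R (tgt a)) == 0%VS by rewrite b0.
    apply/lfunP => x; apply: bI.
    have := congr1 (fun r : R => r a) Auc; rewrite AE ffunE /=.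
    move=> /subr0_eq e; rewrite -!comp_lfunE -comp_lfunZr -e.
    by rewrite -comp_lfunZr -vbu !scalerA mulrC.
  exists (c / c0); congr (_, _); last by rewrite /= /GRing.scale /= divfK.
  apply/ffunP => a; rewrite dirsumZE; apply: (scalerI c0n0).
  by rewrite uc scalerA mulrCA divff// mulr1.
have [|||y [yp y0 _ Ay]] := @kernel_deformation _ _ _ A fullv ((u0, c0 : k^o) : P) Ap.
- apply: generically_mono gen => t [bt vt].
  have d0 := limg_ker_dim (A 0) fullv; have dt := limg_ker_dim (A t) fullv.
  rewrite -(leq_add2l (\dim (fullv :&: lker (A 0%R)))) d0 -dt leq_add2r !capfv.
  apply: leq_trans (dimvS ker0) _; rewrite dim_vline.
  apply: leq_trans (leq_b1 _) _; rewrite lt0n dimv_eq0; apply/negP => /eqP ker_t.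
  pose u1 : rep_sum E E := [ffun a => ((b t (tgt a))^-1 \o v t a \o b t (src a))%VF
                                        : 'Hom(E (src a), E (tgt a))].
  have : ((u1, 1 : k^o) : P) \in lker (A t).
    rewrite memv_ker; apply/eqP/ffunP => a; rewrite AE /= ffunE /=.
    rewrite scale1r ffunE; apply/lfunP => x.
    rewrite add_lfunE opp_lfunE !comp_lfunE lfunE limg_lfunVK ?subrr//.
    by apply: (subvP (vt a)); rewrite memv_img// memv_img// memvf.
  by rewrite ker_t memv0 => /eqP[_ /eqP]; rewrite oner_eq0.
- exact: memvf.
- apply/ffunP => a; rewrite AE /= vbu subrr; by rewrite ffunE.
have [fstL fstE] := @lfun_exists _ P (rep_sum E E) fst (fun _ _ _ => erefl).
have [sndL sndE] := @lfun_exists _ P k^o snd (fun _ _ _ => erefl).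
exists (fun t => (y t).2), (fun t => (y t).1); split.
- have [n [a ya]] := polycurve_lin sndL yp; exists (\poly_(i < n) (a i)) => t.
  rewrite -sndE ya horner_poly; apply: eq_bigr => i _.
  by rewrite /GRing.scale /= mulrC.
- by rewrite y0.
- by apply: eq_polycurve (polycurve_lin fstL yp) => t; exact: fstE.
- by rewrite y0.
move=> t a; have := congr1 (fun r : R => r a) (Ay t).
by rewrite AE ffunE => /subr0_eq.
Qed.

End Intertwiner.

Section KernelCurves.
Variables (k : numFieldType) (Q : quiver) (V W : vertex Q -> vectType (k : fieldType)).
Variables (l : vertex Q -> nat) (F : subspace_chain V l) (G : subspace_chain W l).
Hypothesis F_filtration : forall x, complete_filtration (@F x).
Variable Phi0 : hom_sum V W.

Local Notation K := (fun x => lker (Phi0 x)).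
Local Notation KV := (subfamily_space K).
Local Notation FK := (induced_chain F K).

Lemma embedding_curve v w (Phi : k -> hom_sum V W) (j : hom_sum KV V) :
  polycurve Phi -> (forall t, is_hom F G (v t) (w t) (Phi t)) ->
  generically (fun t => same_ranks F G (Phi t) Phi0) -> same_ranks F G (Phi 0%R) Phi0 ->
  j \in filtered_hom FK F -> (forall x, (Phi 0%R x \o j x)%VF = 0) ->
  (forall x, lker (j x) = 0%VS) ->
  exists b, [/\ polycurve b, b 0 = j, forall t, b t \in filtered_hom FK F,
    forall t x, (Phi t x \o b t x)%VF = 0 &
    generically (fun t => (forall x, lker (b t x) = 0%VS) /\ subrep (v t) (image_family (b t)))].
Proof.
move=> Pp Ph sr sr0 jF Pj0 jinj.
have Pj : postcomp Phi0 (Phi 0) j = 0.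
  by apply/ffunP => x; rewrite postcompE Pj0 ffunE.
have [|b [bp b0 bF Pb]] := @kernel_deformation _ (hom_sum KV V) (hom_sum KV W)
    (fun t => postcomp Phi0 (Phi t)) _ _ (postcomp_polycurve Phi0 Pp) _ jF Pj.
  apply: generically_mono sr => t st /=.
  have := limg_ker_dim (postcomp Phi0 (Phi t)) (filtered_hom FK F).
  rewrite -(limg_ker_dim (postcomp Phi0 (Phi 0%R)) (filtered_hom FK F)).
  by rewrite (dim_ker_postcomp F_filtration st sr0) => /addnI ->.
have Pb' t x : (Phi t x \o b t x)%VF = 0.
  have := congr1 (fun r : hom_sum KV W => r x) (Pb t).
  by rewrite postcompE ffunE.
exists b; split=> //.
have binj : generically (fun t => forall x, lker (b t x) = 0%VS).
  apply: generically_forall => x.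
  have := rank_semicontinuous fullv 0 (polycurve_hom_coord x bp).
  apply: generically_mono => t; rewrite b0 => le.
  have := limg_ker_dim (b t x) fullv; have := limg_ker_dim (j x) fullv.
  rewrite jinj capv0 dimv0 add0n => <-; rewrite capfv => e.
  by apply/eqP; rewrite -dimv_eq0 -leqn0 -(leq_add2r (\dim (limg (b t x)))) e add0n.
apply: generically_mono (generically_and binj sr) => t [bi st]; split=> //.
have [_ lim] := @embedding_kernel _ _ _ _ _ F G F_filtration Phi0 (Phi t) (b t) st
  (bF t) (Pb' t) bi.
by move=> a; rewrite /image_family !lim; exact: (is_hom_ker (Ph t)).
Qed.

End KernelCurves.

Section KernelGenericSub.
Variables (k : numFieldType) (Q : quiver) (V W : vertex Q -> vectType (k : fieldType)).
Variables (l : vertex Q -> nat) (F : subspace_chain V l) (G : subspace_chain W l).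
Hypothesis F_filtration : forall x, complete_filtration (@F x).
Variables (v0 : rep_sum V V) (w0 : rep_sum W W) (Phi0 : hom_sum V W).
Hypothesis Phi0_max : max_hom F G v0 w0 Phi0.

Local Notation K := (fun x => lker (Phi0 x)).
Local Notation KV := (subfamily_space K).
Local Notation FK := (induced_chain F K).

(** The embedding [j] identifies the model kernel with the kernel of [Phi], and [u] is [c] times the
    representation that [v] induces on it. The factor [c] is part of the data because only the
    rescaled representation moves polynomially. *)
Definition kernel_open (O : rep_sum KV KV -> Prop) (v : rep_sum V V) : Prop :=
  exists (w : rep_sum W W) (Phi : hom_sum V W) (j : hom_sum KV V) (c : k)
         (u : rep_sum KV KV),
  [/\ \dim (Ext F G v w) = ext F G, is_hom F G v w Phi, same_ranks F G Phi Phi0 &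
      [/\ j \in filtered_hom FK F, forall x, lker (j x) = 0%VS,
          forall x, (Phi x \o j x)%VF = 0, c != 0 /\
          forall a, c *: (v a \o j (src a))%VF = (j (tgt a) \o u a)%VF & O u]].

(** Minimality of Ext is known at [v0] and membership in [O] at [u1]. A line of representations from
    [v0 + d], inducing [u1] on the kernel, to [v0] meets both conditions at some parameter. *)
Lemma kernel_open_nonempty O : (exists u, O u) ->
  (forall u : k -> rep_sum KV KV, polycurve u -> O (u 0) -> generically (fun t => O (u t))) ->
  exists v, kernel_open O v.
Proof.
move=> [u1 Ou1] Oopen; have [vw0 hPhi0 _] := Phi0_max.
have [Phi0g /delta0P dPhi0] := hPhi0.
pose i x : 'Hom(KV x, V x) := linfun (vsval : subvs_of (K x) -> V x).
pose p x : 'Hom(V x, KV x) := linfun (vsproj (K x)).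
have iE x u : i x u = vsval u by rewrite lfunE.
have pi x : (p x \o i x)%VF = \1%VF.
  by apply/lfunP => u; rewrite comp_lfunE !lfunE /= vsvalK.
have ip x u : u \in K x -> i x (p x u) = u.
  by move=> uK; rewrite iE lfunE /= vsprojK.
have Phii x : (Phi0 x \o i x)%VF = 0.
  apply/lfunP => u; rewrite comp_lfunE zero_lfunE iE; apply/eqP.
  by rewrite -memv_ker subvsP.
pose u0 : rep_sum KV KV :=
  [ffun a => (p (tgt a) \o v0 a \o i (src a))%VF : 'Hom(KV (src a), KV (tgt a))].
(* It changes the induced representation from [u0] to [u1] and takes values in the kernel, so [Phi0]
   remains a homomorphism along the whole line. *)
pose d : rep_sum V V :=
  [ffun a => (i (tgt a) \o (u1 a - u0 a) \o p (src a))%VF : 'Hom(V (src a), V (tgt a))].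
have v0i a : (v0 a \o i (src a))%VF = (i (tgt a) \o u0 a)%VF.
  apply/lfunP => u; rewrite !comp_lfunE ffunE !comp_lfunE ip//.
  apply: (subvP (is_hom_ker hPhi0 a)); apply: memv_img.
  by rewrite iE subvsP.
pose v s : rep_sum V V := (v0 + d) + s *: (- d).
pose u s : rep_sum KV KV := u1 + s *: (u0 - u1).
have vp : polycurve v := polycurve_rep_line _ _.
have up : polycurve u := polycurve_rep_line _ _.
have wp := polycurve_rep_cst w0.
have v1 : v 1 = v0 by rewrite /v scale1r addrK.
have Ou : generically (fun s => O (u s)).
  by apply: Oopen up _; rewrite /u scale0r addr0.
have Eg := Ext_semicontinuous F G 1 vp wp.
have [s [Os Es]] := generically_ex (generically_and Ou Eg).
have vsa a : v s a = v0 a + (1 - s) *: d a.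
  by rewrite /v !dirsumDE dirsumZE -addrA scalerBl scale1r -scalerN; congr (_ + (_ + _ *: _));
     rewrite ffunE.
have usa a : u s a = u0 a + (1 - s) *: (u1 a - u0 a).
  rewrite /u dirsumDE dirsumZE dirsumDE.
  have -> : (- u1 : rep_sum KV KV) a = - u1 a by rewrite ffunE.
  by rewrite scalerBl scale1r addrA [u0 a + (u1 a - _)]addrC subrK -scalerN opprB.
pose iF : hom_sum KV V := [ffun x => i x : 'Hom(KV x, V x)].
have iFE x : iF x = i x by exact: ffunE.
exists (v s), w0, Phi0, iF, 1, (u s).
split=> //.
- by apply/eqP; rewrite eqn_leq ext_le andbT; move: Es; rewrite v1 vw0.
- split=> //; apply/delta0P => a; rewrite vsa comp_lfunDr dPhi0.
  by rewrite -comp_lfunZr ffunE !comp_lfunA Phii !comp_lfun0l scaler0 addr0.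
split=> //.
- apply/filtered_homP => x j; rewrite iFE; apply/subvP => _ /memv_imgP[z + ->].
  by rewrite mem_induced_chain iE memv_cap => /andP[].
- move=> x; apply/eqP/lker0P => z z'; rewrite iFE !iE; exact: subvs_inj.
- by move=> x; rewrite iFE.
split; first exact: oner_neq0.
move=> a.
have dE : d a = (i (tgt a) \o (u1 a - u0 a) \o p (src a))%VF by exact: ffunE.
rewrite scale1r !iFE vsa usa.
rewrite comp_lfunDl v0i comp_lfunDr; congr (_ + _).
by rewrite -comp_lfunZl -comp_lfunZr dE -!comp_lfunA pi comp_lfun1r.
Qed.

(** A curve [v] is lifted in turn to homomorphisms, to embeddings [b] of their kernels, and to
    representations [uu] on the model kernel. Generic subrepresentations of [uu] are then carried
    into [V] by [b]. *)
Lemma generic_sub_kernel (D : vertex Q -> vectType (k : fieldType)) (FD : subspace_chain D l) :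
  generic_sub FD FK -> generic_sub FD F.
Proof.
move=> [U [Uex UP]]; exists (kernel_open U); split.
  by apply: kernel_open_nonempty => // u up /(UP u up)[].
move=> v vp [w [Phi [j [c [u [vw hPhi sr [jF jinj Phij [cn0 cvj] Ou]]]]]]].
have wp := polycurve_rep_cst w.
have [y [yp y0 yh]] := hom_deformation vp wp vw hPhi.
have sr0 : same_ranks F G (y 0) Phi0 by rewrite y0.
have srt := hom_curve_same_ranks Phi0_max vp wp yp yh vw sr0.
have yj x : (y 0 x \o j x)%VF = 0 by rewrite y0.
have [b [bp b0 bF yb binj]] := embedding_curve F_filtration yp yh srt sr0 jF yj jinj.
have [||cc [uu [ccp cc0 uup uu0 ccE]]] :=
    @intertwiner_curve _ _ KV V v b c u vp bp _ cn0 _ binj.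
- by move=> x; rewrite b0.
- by move=> a; rewrite b0.
have [Ouu [jj jjp jjE]] := UP uu uup (eq_ind_r U Ou uu0).
have ccn0 : generically (fun t => cc t != 0).
  by apply: (polyfun_neq0 (t0 := 0) ccp); rewrite cc0.
split.
  have Eg := Ext_semicontinuous F G 0 vp wp.
  apply: generically_mono (generically_and (generically_and Ouu ccn0)
    (generically_and (generically_and srt binj) Eg)) => t [[Ot ct] [[st [bt _]] Et]].
  exists w, (y t), (b t), (cc t), (uu t); split=> //.
  by apply/eqP; rewrite eqn_leq ext_le andbT; move: Et; rewrite vw.
exists (fun t => [ffun x => (b t x \o jj t x)%VF : 'Hom(D x, V x)]).
  apply: polycurve_hom => x; apply: eq_polycurve
    (polycurve_comp (polycurve_hom_coord x bp) (polycurve_hom_coord x jjp)) => t.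
  by rewrite ffunE.
apply: generically_mono (generically_and (generically_and jjE ccn0)
   (generically_and srt binj)) => t [[[emb sub] ct] [st [bt _]]].
split.
  apply: embedding_comp emb.
  by have [] := embedding_kernel F_filtration st (bF t) (yb t) bt.
move=> a; rewrite /image_family !ffunE !limg_comp.
apply/subvP => _ /memv_imgP[_ /memv_imgP[z zj ->] ->].
have : (cc t *: (v t a \o b t (src a))%VF) z = (b t (tgt a) \o uu t a)%VF z by rewrite ccE.
rewrite scale_lfunE !comp_lfunE => e.
rewrite -[v t a _](scalerK ct) e rpredZ// memv_img//.
by apply: (subvP (sub a)); exact: memv_img.
Qed.

End KernelGenericSub.

(** * Euler numbers of isometric subfamilies *)

(** Summation by parts: [b] has its mass at earlier indices, where the weight [g] is smaller. *)
Lemma leq_weighted_sum (a b g : nat -> nat) (m : nat) :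
  (forall n, (n <= m)%N -> (\sum_(i < n.+1) a i <= \sum_(i < n.+1) b i)%N) ->
  (forall n, (n < m)%N -> (g n <= g n.+1)%N) ->
  (\sum_(i < m.+1) a i = \sum_(i < m.+1) b i)%N ->
  (\sum_(i < m.+1) b i * g i <= \sum_(i < m.+1) a i * g i)%N.
Proof.
move=> ab gmono abm.
(* The added terms compensate for partial totals that need not agree before [m]; at [m] they
   cancel. *)
suff H n : (n <= m)%N ->
    (\sum_(i < n.+1) b i * g i + (\sum_(i < n.+1) a i) * g n
     <= \sum_(i < n.+1) a i * g i + (\sum_(i < n.+1) b i) * g n)%N.
  by have := H m (leqnn m); rewrite abm leq_add2r.
elim: n => [|n IHn] nm; first by rewrite !big_ord1 addnC.
have := IHn (ltnW nm); have := ab n (ltnW nm); have := gmono n nm.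
rewrite !(big_ord_recr n.+1) /=.
set A := (\sum_(i < n.+1) a i)%N; set B := (\sum_(i < n.+1) b i)%N.
set X := (\sum_(i < n.+1) b i * g i)%N; set Y := (\sum_(i < n.+1) a i * g i)%N.
move=> gn AB le; have : ((B - A) * g n <= (B - A) * g n.+1)%N by rewrite leq_mul2l gn orbT.
move: le; rewrite !mulnBl !mulnDl.
have : (A * g n <= B * g n)%N by rewrite leq_mul2r AB orbT.
have : (A * g n.+1 <= B * g n.+1)%N by rewrite leq_mul2r AB orbT.
by lia.
Qed.

Section Eul.
Variables (K : fieldType) (Q : quiver) (V W : vertex Q -> vectType K).
Variables (l : vertex Q -> nat) (F : subspace_chain V l) (G : subspace_chain W l).
Hypothesis F_filtration : forall x, complete_filtration (@F x).
Hypothesis G_mono : forall x, {homo @G x : i j / (i <= j)%N >-> (i <= j)%VS}.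

Lemma eul_codim : eul F G =
  (hom_codim F G (fun=> fullv) (fun=> 0%VS))%:Z
  - (@rep_codim _ _ V W (fun=> fullv) (fun=> 0%VS))%:Z.
Proof.
rewrite /eul; congr (_%:Z - _%:Z).
  rewrite (dim_filtered_mapsto F_filtration G_mono (fun=> fullv) (fun=> 0%VS)).
  have -> : @hom_mapsto _ _ V W (fun=> fullv) (fun=> 0%VS) = 0%VS.
    apply/eqP; rewrite -subv0; apply/subvP => f /hom_mapstoP f0.
    rewrite memv0; apply/eqP/ffunP => x; rewrite ffunE; apply/lfunP => u.
    by have := subvP (f0 x) _ (memv_img _ (memvf u)); rewrite memv0 lfunE => /eqP.
  by rewrite capv0 dimv0.
rewrite (@dim_rep_mapsto _ _ V W l F F_filtration (fun=> fullv) (fun=> 0%VS)).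
have -> : @rep_mapsto _ _ V W (fun=> fullv) (fun=> 0%VS) = 0%VS.
  apply/eqP; rewrite -subv0; apply/subvP => f /rep_mapstoP f0.
  rewrite memv0; apply/eqP/ffunP => x; rewrite ffunE; apply/lfunP => u.
  by have := subvP (f0 x) _ (memv_img _ (memvf u)); rewrite memv0 lfunE => /eqP.
by rewrite dimv0.
Qed.

End Eul.

Section EulInduced.
Variables (K : fieldType) (Q : quiver) (V W : vertex Q -> vectType K).
Variables (l : vertex Q -> nat) (F : subspace_chain V l) (G : subspace_chain W l).
Hypothesis F_filtration : forall x, complete_filtration (@F x).
Hypothesis G_mono : forall x, {homo @G x : i j / (i <= j)%N >-> (i <= j)%VS}.

Lemma eul_induced (S : subfamily V) : eul (induced_chain F S) G =
  (hom_codim F G S (fun=> 0%VS))%:Z - (rep_codim S (fun x => 0%VS : {vspace W x}))%:Z.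
Proof.
rewrite eul_codim// => [|x]; last exact: induced_filtration.
congr (_%:Z - _%:Z).
  by apply: eq_bigr => x _; apply: eq_bigr => i _; rewrite jump_induced.
by apply: eq_bigr => a _; rewrite dimvf.
Qed.

Lemma eul_isometric (D : vertex Q -> vectType K) (FD : subspace_chain D l) (S : subfamily V) :
  (forall x, complete_filtration (@FD x)) ->
  (forall x i, \dim (FD x i) = \dim (@F x i :&: S x)) ->
  eul (induced_chain F S) G = eul FD G.
Proof.
move=> cD dS; rewrite eul_induced eul_codim//; congr (_%:Z - _%:Z).
  apply: eq_bigr => x _; apply: eq_bigr => i _; congr (_ * _)%N.
  by rewrite /jump !capvf !dS.
apply: eq_bigr => a _; congr (_ * _)%N.
have [_ DT _] := cD (src a); have [_ FT _] := F_filtration (src a).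
by rewrite -DT dS FT capfv.
Qed.

(** The hypothesis records the positions of stable subfamilies, a consequence of Q-intersection free
    of topology. It feeds [leq_weighted_sum] with the jumps of [S] and [T] as masses and the
    dimensions of [G] as weights. *)
Lemma ext_lower_bound (S : subfamily V) :
  (forall v : rep_sum V V, exists2 T : subfamily V, subrep v T &
     forall x, \dim (T x) = \dim (S x) /\
     forall i, (\dim (@F x i :&: S x) <= \dim (@F x i :&: T x))%N) ->
  - eul (induced_chain F S) G <= (ext F G)%:Z.
Proof.
move=> ST.
suff H (v : rep_sum V V) (w : rep_sum W W) :
    (rep_codim S (fun x => 0%VS : {vspace W x}) <=
     \dim (Ext F G v w) + hom_codim F G S (fun=> 0%VS))%N.
  rewrite eul_induced opprB /ext; case: ex_minnP => n /asboolP[v [w ->]] _.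
  by rewrite lerBlDr -PoszD lez_nat.
have [T vT dT] := ST v.
have w0 : subrep w (fun=> 0%VS) by move=> a; rewrite limg0 sub0v.
have := Ext_lower_bound F_filtration G_mono vT w0.
have -> : rep_codim T (fun x => 0%VS : {vspace W x}) = rep_codim S (fun x => 0%VS : {vspace W x}).
  by apply: eq_bigr => a _; rewrite (dT _).1.
move=> /leq_trans; apply; rewrite leq_add2l.
apply: leq_sum => x _.
pose g n := (\dim (@G x (inord n) : {vspace W x}) - \dim (@G x (inord n) :&: 0))%N.
have gE (i : 'I_(l x).+1) : (\dim (@G x i) - \dim (@G x i :&: 0) = g i)%N.
  by rewrite /g inord_val.
under eq_bigr do rewrite gE; under [X in (_ <= X)%N]eq_bigr do rewrite gE.
have dims U n : (n <= l x)%N ->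
    \dim (@F x (inord n) :&: U) = (\sum_(i < n.+1) jump (@F x) U i)%N.
  move=> nl; rewrite (dim_sum_jump (F_filtration x)) inordK//.
  rewrite [RHS](big_ord_widen (l x).+1 (fun j => jump (@F x) U j : nat))// [RHS]big_mkcond /=.
  by apply: eq_bigr => j _; rewrite ltnS; case: ifP; rewrite ?mul1n.
apply: (@leq_weighted_sum (jump (@F x) (S x)) (jump (@F x) (T x)) g) => [n nl|n nl|].
- by rewrite -!dims//; exact: (dT x).2.
- by rewrite /g !capv0 dimv0 !subn0; apply/dimvS/G_mono; rewrite !inordK// ltnS// ltnW.
by rewrite -!(dim_sum_jumpT (F_filtration x)) (dT x).1.
Qed.

End EulInduced.

(** [D] is an abstract filtered family, not a subfamily of [V], because the induction replaces [V]
    by the spaces underlying a kernel. *)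
Lemma generic_sub_ext (k : numFieldType) (Q : quiver) (W : vertex Q -> vectType (k : fieldType))
    (l : vertex Q -> nat) (G : subspace_chain W l) :
  (forall x, {homo @G x : i j / (i <= j)%N >-> (i <= j)%VS}) ->
  forall (V : vertex Q -> vectType (k : fieldType)) (F : subspace_chain V l),
  (forall x, complete_filtration (@F x)) ->
  exists (D : vertex Q -> vectType (k : fieldType)) (FD : subspace_chain D l),
    [/\ forall x, complete_filtration (@FD x), generic_sub FD F
      & (ext F G)%:Z <= - eul FD G].
Proof.
move=> Gmono V; have [n] := ubnP (\sum_x \dim {: V x}).
elim: n V => // n IHn V Vn F cF.
have [v [w [Phi Pmax]]] := max_hom_exists F G.
have [Phi0|/existsNP[x0 Phix]] := pselect (forall x, lker (Phi x) = fullv).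
  exists V, F; split=> //; first exact: generic_sub_refl.
  rewrite eul_codim// opprB lerBrDr -PoszD lez_nat.
  have := max_hom_ext cF Gmono Pmax.
  have I0 x : limg (Phi x) = 0%VS by apply/eqP; rewrite -lkerE Phi0 subvv.
  have -> : (fun x => lker (Phi x)) = (fun x => fullv).
    exact: functional_extensionality_dep.
  have -> // : (fun x => limg (Phi x)) = (fun x => 0%VS).
  exact: functional_extensionality_dep.
pose K x := lker (Phi x).
have [||D [FD [cD gD eD]]] := IHn (subfamily_space K) _ (induced_chain F K).
- have lt : (\sum_x \dim (K x) < \sum_x \dim {: V x})%N.
    rewrite (bigD1 x0)//= [X in (_ < X)%N](bigD1 x0)//= -addSn leq_add//.
      rewrite ltnNge; apply/negP => le; apply: Phix.
      by apply/eqP; rewrite eqEdim subvf.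
    by apply: leq_sum => x _; exact/dimvS/subvf.
  rewrite -ltnS (leq_trans _ Vn)// ltnS (leq_ltn_trans _ lt)//.
  by apply: leq_sum => x _; rewrite dimvf.
- by move=> x; exact: induced_filtration.
exists D, FD; split=> //; first exact: (generic_sub_kernel cF Pmax gD).
by apply: Order.POrderTheory.le_trans eD; rewrite lez_nat; exact: (ext_kernel cF Gmono Pmax).
Qed.

(** * Orbit closures along polynomial curves *)

Section Continuity.
Variable (C : numFieldType).

Lemma continuous_sum_fun (T : topologicalType) (I : Type) (r : seq I) (f : I -> T -> C) :
  (forall i, continuous (f i)) -> continuous (fun x => \sum_(i <- r) f i x).
Proof.
move=> fc; elim: r => [|i r IHr] x.
  by under eq_fun do rewrite big_nil; exact: cvg_cst.
under eq_fun do rewrite big_cons; rewrite /continuous_at.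
by apply: cvgD; [exact: fc|exact: IHr].
Qed.

Lemma continuous_prod_fun (T : topologicalType) (I : Type) (r : seq I) (f : I -> T -> C) :
  (forall i, continuous (f i)) -> continuous (fun x => \prod_(i <- r) f i x).
Proof.
move=> fc; elim: r => [|i r IHr] x.
  by under eq_fun do rewrite big_nil; exact: cvg_cst.
under eq_fun do rewrite big_cons; rewrite /continuous_at.
by apply: cvgM; [exact: fc|exact: IHr].
Qed.

Lemma continuous_mul_cst (T : topologicalType) (f : T -> C) (c : C) :
  continuous f -> continuous (fun x => f x * c).
Proof. by move=> fc x; apply: cvgM; [exact: fc|exact: cvg_cst]. Qed.

Lemma continuous_det (T : topologicalType) n (N : T -> 'M[C]_n) :
  (forall i j, continuous (fun x => N x i j)) -> continuous (fun x => \det (N x)).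
Proof.
move=> Nc; apply: continuous_sum_fun => s x.
by apply: cvgM; [exact: cvg_cst|exact: continuous_prod_fun].
Qed.

Lemma horner_continuous (p : {poly C}) : continuous (fun t : C => p.[t]).
Proof.
have -> : (fun t : C => p.[t]) = (fun t => \sum_(i < size p) t ^+ i * p`_i).
  apply/funext => t; rewrite horner_coef; apply: eq_bigr => i _; exact: mulrC.
have powc m : continuous (fun t : C => t ^+ m).
  elim: m => [|m IHm].
    have -> : (fun t : C => t ^+ 0) = cst 1 by apply/funext => t; rewrite expr0.
    exact: cst_continuous.
  have -> : (fun t : C => t ^+ m.+1) = (fun t => t * t ^+ m).
    by apply/funext => t; rewrite exprS.
  by move=> x; apply: (@continuousM C C id); [by move=> ?|exact: IHm].
by apply: continuous_sum_fun => i; apply: continuous_mul_cst; exact: powc.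
Qed.

Lemma generically_nbhs (P : C -> Prop) (t0 : C) (U : set C) :
  generically P -> nbhs t0 U -> exists2 t, U t & P t.
Proof.
move=> [p p0 pP] /nbhs_ballP[e /= e0 eU]; apply: contrapT => no.
(* With [n.+2] the distance to [t0] is strictly below [e] already for [n = 0], so infinitely many
   points of the ball are listed. *)
pose f (n : nat) : C := t0 + e / n.+2%:R.
have nz (n : nat) : (n.+2%:R : C) != 0 by rewrite pnatr_eq0.
have fU n : U (f n).
  apply: eU; rewrite /ball /= /f opprD addNKr normrN normrM (gtr0_norm e0) gtr0_norm.
    rewrite ltr_pdivrMr ?ltr0n// ltr_pMr// (_ : 1 = 1%:R)// ltr_nat//.
  by rewrite invr_gt0 ltr0n.
pose s := [seq f n | n <- iota 0 (size p).+1].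
have us : uniq s.
  rewrite map_inj_uniq ?iota_uniq// => m n /addrI /(mulfI (lt0r_neq0 e0))/invr_inj/eqP.
  by rewrite eqr_nat => /eqP[].
have := max_poly_roots p0 _ us; rewrite size_map size_iota.
have -> : all (root p) s.
  apply/allP => _ /mapP[n _ ->]; apply: contrapT => /negP nr.
  by apply: no; exists (f n) => //; exact: pP.
by move=> /(_ isT); rewrite ltnNge leqnSn.
Qed.

Lemma polyfun_mx_nbhs m n (M : C -> 'M[C]_(m, n)) t0 (A : set 'M[C]_(m, n)) :
  (forall i j, polyfun (fun t => M t i j)) -> nbhs (M t0) A ->
  nbhs t0 [set t | A (M t)].
Proof.
move=> Mp [P MP PA].
have : nbhs t0 [set t | forall i j, P i j (M t i j)].
  apply: (@filter_forall _ _ (fun i t => forall j, P i j (M t i j)) (nbhs t0)) => i.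
  apply: (@filter_forall _ _ (fun j t => P i j (M t i j)) (nbhs t0)) => j.
  have [p pE] := Mp i j; have MPij := MP i j; rewrite pE in MPij.
  have pP : nbhs t0 [set t | P i j p.[t]] := horner_continuous MPij.
  by apply: filterS pP => t /=; rewrite pE.
by apply: filterS => t Pt; exact: PA.
Qed.

End Continuity.

Section Frames.
Variables (C : numFieldType) (E : vectType C) (r : nat).
Local Notation e := (vbasis {:E}).
Local Notation n := (\dim {:E}).

Lemma frame_lfun_exists (M : 'M[C]_(r, n)) : exists f : 'Hom('rV[C]_r, E),
  forall x, f x = passmx.vecof e (x *m M).
Proof.
apply: lfun_exists => a x y.
by rewrite mulmxDl -scalemxAl; exact: passmx.vecof_linear.
Qed.

Definition frame_lfun M := projT1 (cid (frame_lfun_exists M)).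

Lemma frame_lfunE M x : frame_lfun M x = passmx.vecof e (x *m M).
Proof. exact: (projT2 (cid (frame_lfun_exists M))). Qed.

Lemma limg_frame_lfun (M : 'M[C]_(r, n)) : limg (frame_lfun M) = frame_span M.
Proof.
apply/eqP; rewrite eqEsubv; apply/andP; split.
  apply/subvP => _ /memv_imgP[x _ ->]; rewrite (row_sum_delta x) linear_sum.
  apply: rpred_sum => i _; rewrite linearZ /=; apply: rpredZ.
  by rewrite frame_lfunE -rowE; apply: memv_span; apply/mapP; exists i; rewrite ?mem_enum.
apply/span_subvP => _ /mapP[i _ ->]; rewrite rowE -(frame_lfunE M).
exact: memv_img (memvf _).
Qed.

(** Dimensions of intersections are upper semicontinuous, because the rank of a frame modulo [U0] is
    detected by a minor that is continuous in the frame. *)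
Lemma grass_open_dim_cap (U0 : {vspace E}) m :
  open [set U : grass r E | (\dim (U0 :&: val U) < m)%N].
Proof.
pose q : 'End(E) := (\1 - projv U0)%VF.
have kerq : lker q = U0.
  apply/vspaceP => u; rewrite memv_ker add_lfunE opp_lfunE id_lfunE subr_eq0.
  by apply/eqP/idP => [->|uG]; [exact: memv_proj|rewrite projv_id].
(* For a frame of [U], [r] is the dimension of the intersection with [U0] plus this rank. *)
exists [set M | (r < m + \dim (limg (q \o frame_lfun M)))%N]; last first.
  move=> U M UM /=; rewrite limg_comp limg_frame_lfun UM.
  have := limg_ker_dim q (val U); rewrite kerq capvC (eqP (valP U)) => rE.
  by rewrite -[X in (X < _)%N]rE ltn_add2r.
rewrite openE => M0 /= rM0; rewrite /interior.
have [u [X [uU Xf AuX]]] := rank_frame (q \o frame_lfun M0)%VF fullv.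
pose N (M : 'M[C]_(r, n)) := gram (q \o frame_lfun M)%VF u X.
have Nc : continuous (fun M => \det (N M)).
  apply: continuous_det => i j.
  have -> : (fun M => N M i j) = (fun M : 'M[C]_(r, n) =>
      \sum_b (\sum_a M a b * u i 0 a) * coord X j (q e`_b)).
    apply/funext => M; rewrite mxE comp_lfunE frame_lfunE /passmx.vecof.
    rewrite linear_sum linear_sum; apply: eq_bigr => b _.
    rewrite linearZ linearZ /= mxE; congr (_ * _).
    by apply: eq_bigr => a _; rewrite mulrC.
  apply: continuous_sum_fun => b; apply: continuous_mul_cst.
  apply: continuous_sum_fun => a; apply: continuous_mul_cst.
  exact: coord_continuous.
have N0 : \det (N M0) != 0 by rewrite /N gram_frame// det1 oner_neq0.
have dN : nbhs (\det (N M0)) [set x : C | x != 0].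
  apply/nbhs_ballP; exists `|\det (N M0)|; first by rewrite /= normr_gt0.
  move=> y; rewrite /ball /=; apply: contraTneq => ->.
  by rewrite subr0 Order.POrderTheory.ltxx.
have nM0 : nbhs M0 [set M | \det (N M) != 0] := Nc _ _ dN.
apply: filterS nM0 => M /= Mn0.
by apply: leq_trans rM0 _; rewrite leq_add2l; apply: gram_dim Mn0.
Qed.

End Frames.

(** * Limits of curves of subspaces by saturation *)

Section Saturation.
Variable (C : numFieldType).
Local Notation ev t := (map_mx (horner_eval t)).

(* While the value at [t1] is rank deficient, a row operation makes one row
   divisible by ['X - t1]; dividing lowers the degree of a nonzero minor. *)
Lemma saturate_mx r n (P : 'M[{poly C}]_(r, n)) (L : 'M[C]_(n, r)) t1 :
  \det (P *m map_mx polyC L) != 0 ->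
  exists2 P' : 'M[{poly C}]_(r, n), row_free (ev t1 P') &
    generically (fun t => (ev t P' :=: ev t P)%MS).
Proof.
have [m] := ubnP (size (\det (P *m map_mx polyC L))).
elim: m P => // m IHm P; rewrite ltnS => dm d0.
have [free|] := boolP (row_free (ev t1 P)).
  by exists P => //; exact: generically_all.
rewrite -kermx_eq0 -nz_row_eq0 => u0; set u := nz_row _ in u0.
have uP : u *m ev t1 P = 0 by apply/sub_kermxP; exact: nz_row_sub.
case: r P L dm d0 u u0 uP IHm => [|r] P L dm d0 u u0 uP IHm.
  by move: u0; rewrite [u]thinmx0 eqxx.
(* An invertible matrix whose first row is proportional to [u], so the first row of [B *m P]
   vanishes at [t1]. *)
pose B := row_ebase u.
have B0 : row 0 B *m ev t1 P = 0.
  have := mulmx_ebase u; rewrite rank_rV u0 -mulmxA => uE.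
  have cu : col_ebase u \in unitmx by exact: col_ebase_unit.
  have -> : row 0 B = pid_mx 1 *m B.
    rewrite rowE; congr (_ *m _); apply/matrixP => i j; rewrite !mxE !ord1.
    by case: j => [[|j] jr].
  by rewrite -(mulKmx cu (pid_mx 1 *m B)) uE -mulmxA uP mulmx0.
pose BP := map_mx polyC B *m P.
have evB t : ev t BP = B *m ev t P.
  rewrite map_mxM; congr (_ *m _); apply/matrixP => i j.
  by rewrite !mxE /= horner_evalE hornerC.
have div j : BP 0 j = (BP 0 j %/ ('X - t1%:P)) * ('X - t1%:P).
  rewrite divpK// dvdp_XsubCl /root.
  have := congr1 (fun M : 'rV[C]_n => M 0 j) B0.
  by rewrite -row_mul -evB !mxE horner_evalE => ->.
pose P' : 'M[{poly C}]_(r.+1, n) :=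
  \matrix_(i, j) if i == 0 then BP 0 j %/ ('X - t1%:P) else BP i j.
pose d : 'rV[{poly C}]_r.+1 := \row_i if i == 0 then 'X - t1%:P else 1.
have dP : diag_mx d *m P' = BP.
  apply/matrixP => i j; rewrite mul_diag_mx mxE [d 0 i]mxE [P' i j]mxE.
  by case: eqVneq => [->|_]; rewrite ?mul1r// mulrC -div.
have dd : \det (diag_mx d) = 'X - t1%:P.
  rewrite det_diag (bigD1 0)//= mxE eqxx big1 ?mulr1// => i i0.
  by rewrite mxE (negPf i0).
have Bdet : \det (map_mx polyC B) = (\det B)%:P by rewrite det_map_mx.
have B_neq0 : \det B != 0 by rewrite -unitfE -unitmxE row_ebase_unit.
have detE : ('X - t1%:P) * \det (P' *m map_mx polyC L)
    = (\det B)%:P * \det (P *m map_mx polyC L).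
  by rewrite -dd -det_mulmx mulmxA dP -mulmxA det_mulmx Bdet.
have P'0 : \det (P' *m map_mx polyC L) != 0.
  have : (\det B)%:P * \det (P *m map_mx polyC L) != 0.
    by rewrite mulf_neq0// polyC_eq0.
  by rewrite -detE mulf_eq0 negb_or => /andP[].
have [||P'' free gen] := IHm P'.
- rewrite (leq_trans _ dm)//.
  have := congr1 (fun p : {poly C} => size p) detE => /=.
  rewrite mulrC size_Mmonic ?monicXsubC// size_XsubC addn2 /= mul_polyC size_scale//.
  by move=> ->.
- by [].
exists P'' => //.
(* Away from [t1] the division only rescales one row by the unit [t - t1], so row spaces are
   unchanged. *)
apply: generically_mono (generically_and gen (generically_neq t1)) => t [e tt].
apply: eqmx_trans e _.
have evd : ev t BP = ev t (diag_mx d) *m ev t P' by rewrite -map_mxM dP.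
have du : ev t (diag_mx d) \in unitmx.
  rewrite unitmxE unitfE.
  have -> : \det (ev t (diag_mx d)) = t - t1.
    by rewrite det_map_mx dd /= horner_evalE hornerXsubC.
  by rewrite subr_eq0.
have Bu : B \in unitmx by exact: row_ebase_unit.
have e1 : (ev t BP :=: ev t P')%MS.
  by rewrite evd; apply: eqmxMfull; rewrite row_full_unit.
have e2 : (ev t BP :=: ev t P)%MS.
  by rewrite evB; apply: eqmxMfull; rewrite row_full_unit.
exact: eqmx_trans (eqmx_sym e1) e2.
Qed.

Section Hommx.
Variables (D E : vectType C).
Local Notation hommx := (passmx.hommx (vbasis {:D}) (vbasis {:E})).

Lemma hommx_limg (M N : 'M[C]_(\dim {:D}, \dim {:E})) :
  (M :=: N)%MS -> limg (hommx M) = limg (hommx N).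
Proof.
suff le M' N' : (M' <= N')%MS -> (limg (hommx M') <= limg (hommx N'))%VS.
  by move=> MN; apply/eqP; rewrite eqEsubv !le ?MN.
move=> /submxP[X ->]; apply/subvP => _ /memv_imgP[u _ ->].
rewrite passmx.hommxE ?vbasisP// mulmxA.
rewrite -[passmx.rVof _ u *m X](passmx.vecofK (vbasisP {:D})).
by rewrite -passmx.hommxE ?vbasisP// memv_img// memvf.
Qed.

Lemma hommx_lker (M : 'M[C]_(\dim {:D}, \dim {:E})) :
  (lker (hommx M) == 0%VS) = row_free M.
Proof.
apply/lker0P/idP => [inj|free].
  rewrite -kermx_eq0 -nz_row_eq0; apply/eqP; set u := nz_row _.
  have uM : u *m M = 0 by apply/sub_kermxP; exact: nz_row_sub.
  apply/eqP; rewrite -(passmx.vecof_eq0 (vbasisP {:D})); apply/eqP/inj.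
  rewrite -passmx.vecof_mul ?vbasisP// uM linear0; apply/eqP.
  by rewrite passmx.vecof_eq0 ?vbasisP.
move=> u v; rewrite !passmx.hommxE ?vbasisP//.
move=> /(can_inj (passmx.vecofK (vbasisP _)))/(row_free_inj free).
exact: (can_inj (passmx.rVofK (vbasisP _))).
Qed.

Lemma saturate_curve (j : C -> 'Hom(D, E)) t1 :
  polycurve j -> generically (fun t => lker (j t) = 0%VS) ->
  exists j' : C -> 'Hom(D, E), [/\ polycurve j', lker (j' t1) = 0%VS &
                 generically (fun t => limg (j' t) = limg (j t))].
Proof.
move=> jp jinj.
pose M t := passmx.mxof (vbasis {:D}) (vbasis {:E}) (j t).
have jM t : j t = hommx (M t) by rewrite passmx.mxofK ?vbasisP.
have Mp i l : polyfun (fun t => M t i l).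
  have [p pE] := polyfun_lin (coord (vbasis {:E}) l)
    (polycurve_app jp (polycurve_cst (passmx.vecof (vbasis {:D}) (delta_mx 0 i)))).
  by exists p => t; rewrite -pE !mxE.
have [P MP] := polyfun_mx Mp.
have [t0 inj0] := generically_ex jinj.
(* The right inverse at one good parameter makes the determinant required by [saturate_mx] equal to
   1 there, hence nonzero as a polynomial. *)
have /row_freeP[L ML] : row_free (M t0) by rewrite -hommx_lker -jM inj0.
have [|P' free gen] := @saturate_mx _ _ P L t1.
  apply/eqP => d0.
  have : (\det (P *m map_mx polyC L)).[t0] = 1.
    rewrite -horner_evalE -det_map_mx map_mxM -MP.
    have -> : map_mx (horner_eval t0) (map_mx polyC L) = L.
      by apply/matrixP => i l; rewrite !mxE horner_evalE hornerC.
    by rewrite ML det1.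
  by rewrite d0 horner0 => /eqP; rewrite eq_sym oner_eq0.
exists (fun t => hommx (map_mx (horner_eval t) P')); split.
- apply: polycurve_lfun => u; apply: eq_polycurve
   (polycurve_sum (index_enum _) (g := fun l t =>
     (\sum_i passmx.rVof (vbasis {:D}) u 0 i * (P' i l).[t]) *: (vbasis {:E})`_l) _) => [t|l].
    rewrite passmx.hommxE ?vbasisP// /passmx.vecof; apply: eq_bigr => l _.
    by rewrite mxE; congr (_ *: _); apply: eq_bigr => i _; rewrite !mxE.
  apply: polycurveZ (polycurve_cst _).
  exists (\sum_i passmx.rVof (vbasis {:D}) u 0 i *: P' i l) => t.
  by rewrite horner_sum; apply: eq_bigr => i _; rewrite hornerZ.
- by apply/eqP; rewrite hommx_lker.
by apply: generically_mono gen => t e; rewrite jM MP; exact: hommx_limg.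
Qed.

End Hommx.

End Saturation.
(** The combined map [A t] on the product has image [limg (j2 t)] generically. Its rank cannot be
    larger at [t1], where injectivity of [j2] already accounts for all of it. *)
Lemma curve_image_closed (C : numFieldType) (D1 D2 E1 E2 : vectType C)
    (v : C -> 'Hom(E1, E2)) (j1 : C -> 'Hom(D1, E1)) (j2 : C -> 'Hom(D2, E2)) t1 :
  polycurve v -> polycurve j1 -> polycurve j2 -> lker (j2 t1) = 0%VS ->
  generically (fun t => (v t @: limg (j1 t) <= limg (j2 t))%VS) ->
  (v t1 @: limg (j1 t1) <= limg (j2 t1))%VS.
Proof.
move=> vp j1p j2p inj gen.
have ex t : exists A : 'Hom((D1 * D2)%type, E2), forall p,
    A p = v t (j1 t p.1) + j2 t p.2.
  apply: lfun_exists => c p q /=.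
  by rewrite !linearP scalerDr addrACA.
pose A t := projT1 (cid (ex t)).
have AE t p : A t p = v t (j1 t p.1) + j2 t p.2 := projT2 (cid (ex t)) p.
have Ap : polycurve A.
  apply: polycurve_lfun => p; apply: eq_polycurve (polycurveD
    (polycurve_app vp (polycurve_app j1p (polycurve_cst p.1)))
    (polycurve_app j2p (polycurve_cst p.2))) => t.
  exact/esym/AE.
have j2A t : (limg (j2 t) <= limg (A t))%VS.
  apply/subvP => _ /memv_imgP[d _ ->].
  have -> : j2 t d = A t (0, d) by rewrite AE /= !linear0 add0r.
  exact: memv_img (memvf _).
have [t [le vt]] := generically_ex (generically_and (rank_semicontinuous fullv t1 Ap) gen).
have At : (limg (A t) <= limg (j2 t))%VS.
  apply/subvP => _ /memv_imgP[d _ ->]; rewrite AE rpredD//.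
    by apply: (subvP vt); rewrite memv_img// memv_img// memvf.
  exact: memv_img (memvf _).
have eqA : limg (j2 t1) = limg (A t1).
  apply/eqP; rewrite eqEdim j2A /= (leq_trans le)// (leq_trans (dimvS At))//.
  rewrite [X in (_ <= X)%N]limg_dim_eq; last by rewrite inj capv0.
  by rewrite -(limg_ker_dim (j2 t) fullv) leq_addl.
rewrite eqA; apply/subvP => _ /memv_imgP[_ /memv_imgP[d _ ->] ->].
have -> : v t1 (j1 t1 d) = A t1 (d, 0) by rewrite AE /= linear0 addr0.
exact: memv_img (memvf _).
Qed.

Lemma polycurve_frame (C : numFieldType) (D E : vectType C) (j : C -> 'Hom(D, E)) r :
  polycurve j -> \dim {:D} = r ->
  exists M : C -> 'M[C]_(r, \dim {:E}),
    (forall i l, polyfun (fun t => M t i l)) /\ forall t, frame_span (M t) = limg (j t).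
Proof.
move=> jp Dr; case: r / Dr.
pose e := vbasis {:E}; pose b := vbasis {:D}.
exists (fun t => \matrix_i passmx.rVof e (j t b`_i)); split=> [i l|t].
  have [p pE] := polyfun_lin (coord e l) (polycurve_app jp (polycurve_cst b`_i)).
  by exists p => t; rewrite -pE !mxE.
have rowE i : passmx.vecof e (row i (\matrix_i passmx.rVof e (j t b`_i))) = j t b`_i.
  by rewrite rowK passmx.rVofK ?vbasisP.
apply/eqP; rewrite eqEsubv; apply/andP; split.
  by apply/span_subvP => _ /mapP[i _ ->]; rewrite rowE memv_img// memvf.
rewrite -[X in (_ @: X <= _)%VS](span_basis (vbasisP {:D})) limg_span.
apply/span_subvP => _ /mapP[_ /tnthP[i ->] ->]; rewrite (tnth_nth 0) -rowE.
by apply: memv_span; apply/mapP; exists i; rewrite ?mem_enum.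
Qed.

(** * Borel orbits, their closures and Q-intersection *)

Section OrbitClosure.
Variables (C : numFieldType) (Q : quiver) (V : vertex Q -> vectType C).
Variables (l : vertex Q -> nat) (F : subspace_chain V l).
Hypothesis F_filtration : forall x, complete_filtration (@F x).

Lemma dim_total x (U : {vspace V x}) : \dim U = \dim (@F x ord_max :&: U).
Proof. by have [_ -> _] := F_filtration x; rewrite capfv. Qed.

Lemma borel_orbit_closure (S : subfamily V) (D : vertex Q -> vectType C)
    (j : C -> hom_sum D V) t1 :
  polycurve j -> (forall x, \dim {: D x} = \dim (S x)) ->
  (forall x, lker (j t1 x) = 0%VS) ->
  generically (fun t => forall x i,
    \dim (@F x i :&: limg (j t x)) = \dim (@F x i :&: S x)) ->
  exists2 T : grass_prod S, closure (@borel_orbit _ _ _ _ F S) T &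
    forall x, val (T x) = limg (j t1 x).
Proof.
move=> jp dD inj gen.
have dT x : \dim (limg (j t1 x)) == \dim (S x).
  by rewrite limg_dim_eq ?inj ?capv0// dD.
pose T : grass_prod S := fun x => Sub (limg (j t1 x)) (dT x).
have TE x : val (T x) = limg (j t1 x) by rewrite SubK.
exists T => // N TN.
(* Where the image has the wrong dimension the value defaults to [T x], which lies in every
   neighbourhood of itself, so [h] still tends to [T]. *)
pose h t : grass_prod S := fun x => insubd (T x) (limg (j t x)).
have hE t x : \dim (limg (j t x)) == \dim (S x) -> val (h t x) = limg (j t x).
  by move=> dt; rewrite val_insubd dt.
have hcvg : h t @[t --> t1] --> T.
  apply/cvg_sup => [|x A]; first exact: (fmap_filter _ (nbhs_filter t1)).
  rewrite nbhsE => -[B [[U oU <-] UT] BA].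
  have [M [Mp MS]] := polycurve_frame (polycurve_hom_coord x jp) (dD x).
  have [A0 oA0 A0U] := oU.
  have MT : is_frame (T x) (M t1) by rewrite /is_frame MS TE.
  have A0M : nbhs (M t1) A0.
    by apply: open_nbhs_nbhs; split=> //; apply/(A0U _ _ MT).
  have near : nbhs t1 [set t | A0 (M t)] := polyfun_mx_nbhs Mp A0M.
  apply: filterS near => t /= A0t; apply: BA => /=.
  have [dt|dt] := boolP (\dim (limg (j t x)) == \dim (S x)).
    by apply/(A0U _ (M t)) => //; rewrite /is_frame MS hE.
  by rewrite /h /insubd insubF ?(negPf dt).
have hN : nbhs t1 [set t | N (h t)] := hcvg _ TN.
have [t Nt St] := generically_nbhs gen hN.
exists (h t); split=> //.
(* At a parameter of generic position the image lies in the orbit itself, not only in its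
   closure. *)
have ex x := same_position_borel (F_filtration x) (fun i => esym (St x i)).
pose b x := projT1 (cid2 (ex x)).
have bB x : borel (@F x) (b x) by rewrite /b; case: cid2.
have bS x : (b x @: S x)%VS = limg (j t x) by rewrite /b; case: cid2.
exists ([ffun x => b x : 'End(V x)] : hom_sum V V) => x; first by rewrite ffunE.
by rewrite ffunE bS hE// (dim_total (limg _)) St -dim_total.
Qed.

Lemma generic_sub_Qintersecting (D : vertex Q -> vectType C) (FD : subspace_chain D l) :
  (forall x, complete_filtration (@FD x)) -> generic_sub FD F ->
  exists2 S : subfamily V, Qintersecting F S &
    forall x i, \dim (FD x i) = \dim (@F x i :&: S x).
Proof.
move=> cD [U [[v0 Uv0] UP]].
have emb_dim (j : hom_sum D V) : embedding FD F j ->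
    forall x i, \dim (@F x i :&: limg (j x)) = \dim (FD x i).
  by move=> [inj jF] x i; rewrite -jF limg_dim_eq// inj capv0.
have v0p := polycurve_rep_cst v0.
have [_ [j0 _ /generically_ex[t0 [emb0 _]]]] := UP _ v0p Uv0.
(* Any generic image represents the orbit, since all of them have the position of [D]; this one
   comes from the constant curve at [v0]. *)
pose S := image_family (j0 t0).
have dS x i : \dim (FD x i) = \dim (@F x i :&: S x) by rewrite emb_dim.
exists S => // vh.
have vp := polycurve_rep_line v0 (vh - v0).
have [|_ [j jp jgen]] := UP _ vp; first by rewrite scale0r addr0.
have jx x : generically (fun t => lker (j t x) = 0%VS).
  by apply: generically_mono jgen => t [[inj _] _].
(* The line reaches the prescribed [vh] at parameter 1, which need not be generic, so the embeddings
   are saturated there. *)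
have sat x := saturate_curve 1 (polycurve_hom_coord x jp) (jx x).
pose j' t : hom_sum D V := [ffun x => projT1 (cid (sat x)) t : 'Hom(D x, V x)].
have j'x x : polycurve (fun t => j' t x).
  have [q _ _] := projT2 (cid (sat x)).
  by apply: eq_polycurve q => t; rewrite ffunE.
have j'p : polycurve j' := polycurve_hom j'x.
have j'inj x : lker (j' 1 x) = 0%VS.
  by rewrite ffunE; have [] := projT2 (cid (sat x)).
have j'lim : generically (fun t => forall x, limg (j' t x) = limg (j t x)).
  apply: generically_forall => x; have [_ _] := projT2 (cid (sat x)).
  by apply: generically_mono => t; rewrite ffunE.
have dD x : \dim {: D x} = \dim (S x).
  by have [_ DT _] := cD x; rewrite (dim_total (S x)) -dS DT.
have [|T Tcl TE] := borel_orbit_closure j'p dD j'inj.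
  apply: generically_mono (generically_and j'lim jgen) => t [jt [emb _]] x i.
  by rewrite jt emb_dim// dS.
exists T => // a; rewrite !TE.
have -> : vh a = (v0 + 1 *: (vh - v0)) a by rewrite scale1r addrC subrK.
apply: (curve_image_closed (polycurve_rep_coord a vp) (j'x _) (j'x _) (j'inj _)).
apply: generically_mono (generically_and j'lim jgen) => t [jt [_ st]].
by rewrite !jt; exact: st.
Qed.

Lemma Qintersecting_positions (S : subfamily V) : Qintersecting F S ->
  forall v : rep_sum V V, exists2 T : subfamily V, subrep v T &
    forall x, \dim (T x) = \dim (S x) /\
    forall i, (\dim (@F x i :&: S x) <= \dim (@F x i :&: T x))%N.
Proof.
move=> QS v; have [T Tcl vT] := QS v; exists (fun x => val (T x)) => // x.
split=> [|i]; first exact/eqP/(valP (T x)).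
rewrite leqNgt; apply/negP => lt.
(* The Borel group preserves [F x i], so the intersection dimension is constant on the orbit; [O]
   would give a neighbourhood of [T] that misses the orbit. *)
pose O := [set U : grass (\dim (S x)) (V x) |
  (\dim (@F x i :&: val U) < \dim (@F x i :&: S x))%N].
have oO : open O by exact: grass_open_dim_cap.
have : nbhs T [set T' : grass_prod S | O (T' x)].
  have := @proj_continuous _ (fun x => grass (\dim (S x)) (V x)) x T O.
  by apply; exact: open_nbhs_nbhs.
move=> /Tcl[T' [[b bB bS] OT']]; move: OT'; rewrite /O /= bS.
have [b0 bF] := bB x.
by rewrite -{1}(bF i) -lker0_img_cap ?b0// limg_dim_eq ?b0 ?capv0// ltnn.
Qed.

Lemma Qintersecting_stable (S : subfamily V) :
  (forall v : rep_sum V V, subrep v S) -> Qintersecting F S.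
Proof.
move=> Sst v; pose T : grass_prod S := fun x => Sub (S x) (eqxx (\dim (S x))).
have TE x : val (T x) = S x by rewrite SubK.
exists T; last by move=> a; rewrite !TE; exact: Sst.
apply: subset_closure; exists ([ffun x => \1%VF : 'End(V x)] : hom_sum V V) => x.
  rewrite ffunE; split=> [|i]; last by rewrite lim1g.
  by apply/eqP/lker0P => u u'; rewrite !id_lfunE.
by rewrite ffunE lim1g TE.
Qed.

End OrbitClosure.

Theorem theorem5p1 (R : realType) (Q : quiver)
    (V W : vertex Q -> vectType R[i]) (l : vertex Q -> nat)
    (F : subspace_chain V l) (G : subspace_chain W l)
    (F_filtration : forall x, complete_filtration (@F x))
    (G_filtration : forall x, complete_filtration (@G x)) :
  [/\ Qintersecting F (fun x => 0%VS),
      Qintersecting F (fun x => fullv) &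
      exists2 m : int,
        is_minimum [set eul (induced_chain F S) G | S in Qintersecting F] m
        & (ext F G)%:Z = - m].
Proof.
have Gmono x := filtration_mono (G_filtration x).
split.
- by apply: Qintersecting_stable => v a; rewrite limg0 subvv.
- by apply: Qintersecting_stable => v a; exact: subvf.
have lower S : Qintersecting F S -> - eul (induced_chain F S) G <= (ext F G)%:Z.
  by move=> /Qintersecting_positions; exact: ext_lower_bound.
have [D [FD [cD gD eD]]] := generic_sub_ext Gmono F_filtration.
have [S QS dS] := generic_sub_Qintersecting F_filtration cD gD.
have eS := eul_isometric F_filtration Gmono cD dS.
exists (- (ext F G)%:Z); last by rewrite opprK.
split.
  exists S => //; apply: oppr_inj; rewrite opprK.
  by apply/eqP; rewrite Order.POrderTheory.eq_le lower//= eS.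
by move=> _ [S' QS' <-]; rewrite lerNl; exact: lower.
Qed.
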